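(* Let $\phi^t\in\mathrm{Diff}^1(M)$ be the flow of the smooth vector field $\mathcal{V}$ on $M$, let $T_m\phi^{t}$ denote the differential of $\phi^{t}$ at $m\in M$, and let $\sigma[A]_{\min}$ denote the smallest eigenvalue of $A$. Suppose there exist $c\in(0,1)$ and $K>0$ such that $$\sup_{m\in M}\|T_m\phi^{-t}\|\le Ke^{c\,\sigma[A]_{\min}t}\quad\text{for all } t\ge0 .$$ Let the dimension of $M$ be $q\ge1$ and let the dimension $N$ of the reservoir space satisfy $N\ge q$. Suppose that $\mathcal{V}$ admits a finite number of fixed points. For each fixed point $m\in M$ let $J_m:T_mM\to T_mM$ denote the Jacobian (linearisation) of $\mathcal{V}$ at $m$. Suppose that for each fixed point $m$: 1. the eigenvalues of $J_m$, denoted $\lambda_1,\ldots,\lambda_q\in\mathbb{C}$, are distinct; 2. the vectors $\{(A+\lambda_j\mathbb{I})^{-1}C\}_{j=1,\ldots,q}$ are linearly independent (in $\mathbb{C}^N$). Then for generic $\omega\in C^1(M,\mathbb{R})$ satisfying $\sup_{m\in M}\|\omega(m)\|<\infty$ and $\sup_{m\in M}\|D\omega(m)\|<\infty$ (that is, for all $\omega$ in an open dense subset of the space of such functions), the generalised synchronisation $$f_{(\omega,\mathcal{V},F)}(m)=\int_0^\infty e^{-A\tau}C\,\omega\phi^{-\tau}(m)\,d\tau$$ of the linear reservoir system $\dot{x}(t)=-Ax(t)+C\,\omega\phi^t(m)$ is an embedding on the set of fixed points of $\mathcal{V}$.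
   Context: $M$ is a smooth manifold, equipped with a Riemannian metric with respect to which the norms of the differentials $T_m\phi^{-t}$ and $D\omega(m)$ are taken. The flow $\{\phi^t\mid t\in\mathbb{R}\}$ of $\mathcal{V}$ is defined for all times and satisfies $\phi^{t_1+t_2}=\phi^{t_1}\phi^{t_2}$; a fixed point is a point $m$ with $\phi^t(m)=m$ for all $t$, and at a fixed point $T_m\phi^{t}=e^{J_mt}$. Juxtaposition denotes composition, e.g. $\omega\phi^t(m)=\omega(\phi^t(m))$. $A$ is a real symmetric positive definite $N\times N$ matrix, $C$ is a real $N\times1$ matrix (a vector in $\mathbb{R}^N$), $\mathbb{I}$ is the identity matrix, and the reservoir map is $F(x,z)=-Ax+Cz$. Function space: the $C^1$ functions with bounded value and bounded derivative carry the $C^1$ norm $\sup_{m}\|\omega(m)\|+\sup_m\|D\omega(m)\|$, and ''generic'' means holding on an open dense subset for this norm. A map $f:M\to\mathbb{R}^N$ is an immersion at $m\in M$ if the derivative $Df(m):T_mM\to\mathbb{R}^N$ exists and has full rank (is injective, as $N\ge q$). For a compact subset $X\subset M$, $f$ is an embedding on $X$ if $f$ is an immersion at each $m\in X$ and the restriction $f|_X$ is injective. *)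

(* Defs.v *)
From HB Require Import structures.
From mathcomp Require Import all_boot all_order all_algebra.
From mathcomp Require Import all_classical all_reals all_analysis.
From mathcomp Require Import complex.
Set Implicit Arguments.
Unset Strict Implicit.
Unset Printing Implicit Defensive.
Import Order.TTheory GRing.Theory Num.Theory.
Import numFieldNormedType.Exports.
Local Open Scope classical_set_scope.
Local Open Scope ring_scope.

Section CkFunctions.
Variables (R : realType) (E W : normedModType R).

Fixpoint Ck_on (k : nat) (U : set E) (f : E -> W) : Prop :=
  if k is k'.+1 then
    (forall x, U x -> differentiable f x) /\ forall v, Ck_on k' U ('D_v f)
  else forall x, U x -> {for x, continuous f}.

Definition smooth_on (U : set E) (f : E -> W) : Prop :=
  forall k, Ck_on k U f.

End CkFunctions.

(* [cmap] and [cinv] are total functions; only their values on [cdom] and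
   [cmap @` cdom] are meaningful. *)
Record chart (R : realType) (q : nat) (M : topologicalType) := Chart {
  cdom : set M;
  cmap : M -> 'rV[R]_q;
  cinv : 'rV[R]_q -> M;
  cdom_open : open cdom;
  cimg_open : open (cmap @` cdom);
  cmapK : forall m, cdom m -> cinv (cmap m) = m;
  cmap_continuous : forall m, cdom m -> {for m, continuous cmap};
  cinv_continuous :
    forall x, (cmap @` cdom) x -> {for x, continuous cinv} }.

Definition cimg (R : realType) (q : nat) (M : topologicalType)
  (a : chart R q M) : set 'rV[R]_q := cmap a @` cdom a.

(* A preferred chart is fixed at each point; it always exists because the atlas
   covers M.  The tangent space at m is then 'rV_q, a tangent vector being given
   by its coordinates in the preferred chart at m. *)
Record manifold (R : realType) (q : nat) := Manifold {
  mcarrier :> topologicalType;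
  manifold_hausdorff : hausdorff_space mcarrier;
  manifold_second_countable : @second_countable mcarrier;
  atlas : set (chart R q mcarrier);
  atlas_smooth : forall a b, atlas a -> atlas b ->
    smooth_on (cmap a @` (cdom a `&` cdom b)) (cmap b \o cinv a);
  chart_at : mcarrier -> chart R q mcarrier;
  chart_at_atlas : forall m, atlas (chart_at m);
  chart_at_dom : forall m, cdom (chart_at m) m }.

Section Manifolds.
Variables (R : realType) (q : nat) (M : manifold R q).
Local Notation tangent := 'rV[R]_q.
Implicit Types (m : M) (v : tangent) (a : chart R q M).

Definition base_coord m : tangent := cmap (chart_at m) m.

Definition C1_fun (w : M -> R) : Prop :=
  forall a, atlas a -> Ck_on 1 (cimg a) (w \o cinv a).

Definition C1_map (psi : M -> M) : Prop :=
  continuous psi /\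
  forall a b, atlas a -> atlas b ->
    Ck_on 1 (cmap a @` (cdom a `&` psi @^-1` cdom b))
      (cmap b \o psi \o cinv a).

Definition Diff1 (psi : M -> M) : Prop :=
  C1_map psi /\
  exists psi', [/\ C1_map psi', cancel psi psi' & cancel psi' psi].

Definition tmap (psi : M -> M) m : tangent -> tangent :=
  'd (cmap (chart_at (psi m)) \o psi \o cinv (chart_at m)) (base_coord m).

Definition tdiff (W : normedModType R) (f : M -> W) m : tangent -> W :=
  'd (f \o cinv (chart_at m)) (base_coord m).

Definition vfield_coord (V : M -> tangent) a (x : 'rV[R]_q) : 'rV[R]_q :=
  let m := cinv a x in
  V m *m jacobian (cmap a \o cinv (chart_at m)) (base_coord m).

Definition smooth_vfield (V : M -> tangent) : Prop :=
  forall a, atlas a -> smooth_on (cimg a) (vfield_coord V a).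

(* The matrix acts on row vectors: v *m J is J_m applied to v.  This is
   meaningful at zeros of V. *)
Definition linearisation (V : M -> tangent) m : 'M[R]_q :=
  jacobian (vfield_coord V (chart_at m)) (base_coord m).

(* Continuity of the trajectory is needed because the derivative is computed
   through [cmap], which is arbitrary outside the domain of the chart. *)
Definition is_flow (V : M -> tangent) (phi : R -> M -> M) : Prop :=
  [/\ forall m, phi 0 m = m,
      forall t1 t2 m, phi (t1 + t2) m = phi t1 (phi t2 m),
      forall m, continuous (phi ^~ m) &
      forall m t, is_derive t (1 : R)
        (fun s => cmap (chart_at (phi t m)) (phi s m)) (V (phi t m))].

Definition fixed_points (phi : R -> M -> M) : set M :=
  [set m | forall t, phi t m = m].

Definition immersion_at (W : normedModType R) (f : M -> W) m : Prop :=
  differentiable (f \o cinv (chart_at m)) (base_coord m) /\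
  injective (tdiff f m).

Definition embedding_on (W : normedModType R) (f : M -> W) (X : set M) : Prop :=
  [/\ compact X, forall m, X m -> immersion_at f m & set_inj X f].

End Manifolds.

Definition posdefmx (R : realType) (n : nat) (A : 'M[R]_n) : Prop :=
  forall v : 'rV[R]_n, v != 0 -> 0 < (v *m A *m v^T) 0 0.

(* [gram m] is the Gram matrix of the inner product on the tangent space at m,
   in the preferred chart; smoothness is that of the Gram matrices in an
   arbitrary chart of the atlas. *)
Record riemannian (R : realType) (q : nat) (M : manifold R q) := Riemannian {
  gram : M -> 'M[R]_q;
  gram_sym : forall m, (gram m)^T = gram m;
  gram_posdef : forall m, posdefmx (gram m);
  gram_smooth : forall a, atlas a ->
    smooth_on (cimg a) (fun x =>
      let m := cinv a x in
      let B := jacobian (cmap (chart_at m) \o cinv a) x in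
      B *m gram m *m B^T) }.

Section Norms.
Variables (R : realType) (q : nat) (M : manifold R q) (g : riemannian M).

Definition tangent_norm (m : M) (v : 'rV[R]_q) : R :=
  Num.sqrt ((v *m gram g m *m v^T) 0 0).

Definition tmap_norm (psi : M -> M) (m : M) : \bar R :=
  ereal_sup [set (tangent_norm (psi m) (tmap psi m v))%:E | v in
    [set v | tangent_norm m v <= 1]].

Definition tdiff_norm (w : M -> R) (m : M) : \bar R :=
  ereal_sup [set `|tdiff w m v|%:E | v in [set v | tangent_norm m v <= 1]].

Definition sup_norm (w : M -> R) : \bar R :=
  ereal_sup [set `|w m|%:E | m in [set: M]].

Definition sup_tdiff_norm (w : M -> R) : \bar R :=
  ereal_sup [set tdiff_norm w m | m in [set: M]].

Definition C1_norm (w : M -> R) : \bar R :=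
  (sup_norm w + sup_tdiff_norm w)%E.

Definition bounded_C1 : set (M -> R) :=
  [set w | [/\ C1_fun w, (sup_norm w < +oo)%E & (sup_tdiff_norm w < +oo)%E]].

Definition C1_ball (w : M -> R) (e : R) : set (M -> R) :=
  [set w' | bounded_C1 w' /\ (C1_norm (w' \- w)%R < e%:E)%E].

Definition C1_open (O : set (M -> R)) : Prop :=
  O `<=` bounded_C1 /\
  forall w, O w -> exists2 e : R, 0 < e & C1_ball w e `<=` O.

Definition C1_dense (O : set (M -> R)) : Prop :=
  forall w (e : R), bounded_C1 w -> 0 < e -> C1_ball w e `&` O !=set0.

Definition generic (P : (M -> R) -> Prop) : Prop :=
  exists O : set (M -> R), [/\ C1_open O, C1_dense O & forall w, O w -> P w].

End Norms.

Definition is_smallest_eigenvalue (R : realType) (n : nat) (A : 'M[R]_n)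
    (s : R) : Prop :=
  eigenvalue A s /\ forall a, eigenvalue A a -> s <= a.

(* The list is with algebraic multiplicity. *)
Definition are_eigenvalues (R : realType) (n : nat) (B : 'M[R]_n)
    (lam : 'I_n -> R[i]) : Prop :=
  char_poly (map_mx (real_complex R) B) = \prod_(j < n) ('X - (lam j)%:P).

Definition expmx (R : realType) (n : nat) (B : 'M[R]_n) : 'M[R]_n :=
  limn (series (fun k => (k`!%:R)^-1 *: B ^+ k)).

Definition gen_sync (R : realType) (q N : nat) (M : manifold R q)
    (A : 'M[R]_N) (C : 'cV[R]_N) (phi : R -> M -> M) (w : M -> R) (m : M) :
    'cV[R]_N :=
  \col_i \int[lebesgue_measure]_(t in `[0, +oo[)
    ((expmx (- (t *: A)) *m C) i 0 * w (phi (- t) m)).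

(* Main.v *)
(* Diagonalising A over R turns the generalised synchronisation into a linear
   combination of the scalar transforms
     G_d(m) = int_0^oo e^{-dt} w(phi^{-t} m) dt
   at the eigenvalues d of A.  At a fixed point m with linearisation J, the bound
   on T phi^{-t} and d > c sigma allow differentiation under the integral, and
   integration by parts gives d DG_d + DG_d J = Dw(m); moreover d G_d(m) = w(m).
   Pairing the first relation with an eigenvector v_j of J of eigenvalue lam_j
   yields
     Df(m) v_j = (Dw(m) v_j) (A + lam_j I)^{-1} C,
   so f is an immersion at m as soon as Dw(m) v_j <> 0 for all j.  The second
   relation gives A f(m) = w(m) C, so f separates the fixed points as soon as w
   does.  Both requirements are implied by the nonvanishing of finitely many
   continuous linear functionals of w, each nonzero on some bump function, and
   such a condition defines an open dense set. *)
Require Import Defs.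
From HB Require Import structures.
From mathcomp Require Import all_boot all_order all_algebra.
From mathcomp Require Import all_classical all_reals all_analysis.
From mathcomp Require Import complex.
From mathcomp Require Import measurable_realfun ring lra.
Set Implicit Arguments.
Unset Strict Implicit.
Unset Printing Implicit Defensive.
Import Order.TTheory GRing.Theory Num.Theory.
Import numFieldNormedType.Exports.
Local Open Scope classical_set_scope.
Local Open Scope ring_scope.

(** Three obstacles shape the argument. The hypotheses make each [phi t] of class C^1 and each
    trajectory differentiable, but give no derivative of T_m phi^t in [t], which integration by
    parts needs. At a fixed point this derivative is obtained from an estimate T_m phi^t h = h + t J
    h + O(t^2 |h|) for small [t] together with the semigroup law; proving the estimate requires
    keeping nearby trajectories inside one chart, since coordinates mean nothing outside it.
    Secondly, the growth bound is expressed in the Riemannian norm whereas the integral is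
    differentiated in coordinates, so the two norms are compared on a ball about the fixed point
    whose radius does not depend on [t]. Thirdly, [w] is real and the eigenvectors of [J] are
    complex: Dw(m) v <> 0 is enforced through a nonzero real or imaginary part of [v], which is a
    real linear condition on [w] fixed by the vector field alone. *)

(** * Laplace transforms on the half-line *)

Section Laplace.
Variable R : realType.
Notation mu := (@lebesgue_measure R).
Implicit Types (a b d t B : R) (f y z : R -> R).

Lemma is_derive_expRM a t :
  is_derive t (1 : R) (fun s => expR (a * s)) (a * expR (a * t)).
Proof.
have h : is_derive t (1 : R) (fun s => a * s) a.
  by apply: is_derive_eq; rewrite /= ?scaler0 ?addr0 ?scale1r [_ *: _]mulr1.
by have := is_derive1_comp (is_derive_expR (a * t)) h; rewrite mulrC.
Qed.

Lemma continuous_expRM a : continuous (fun s => expR (a * s)).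
Proof.
move=> t; apply: differentiable_continuous; apply/derivable1_diffP.
by have [] := is_derive_expRM a t.
Qed.

Lemma cvg_expR_decay a : 0 < a -> expR (- a * t) @[t --> +oo] --> (0 : R).
Proof.
move=> a0; have h : (a * t @[t --> +oo] --> +oo)%R.
  by apply: gt0_cvgMry => //; exact: cvg_id.
rewrite (_ : (fun t => _) = (fun t => expR (- t)) \o (fun t => a * t)).
  exact: cvg_comp h (@cvgr_expR R).
by apply/funext => t /=; rewrite mulNr.
Qed.

Lemma integrable_expR_decay a : 0 < a ->
  mu.-integrable `[0, +oo[ (EFin \o (fun t => expR (- a * t))).
Proof.
move=> a0; have a1 : a != 0 by rewrite gt_eqF.
have c := @continuous_expRM (- a).
apply/integrableP; split.
  apply/measurable_EFinP; apply: measurable_funTS.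
  exact: continuous_measurable_fun.
under eq_integral do rewrite /= ger0_norm ?expR_ge0//.
have dF t : is_derive t (1 : R) (fun s => - a^-1 * expR (- a * s))
    (expR (- a * t)).
  have := is_deriveZ (- a^-1) (is_derive_expRM (- a) t).
  by rewrite /GRing.scale/= mulrA mulrNN mulVf// mul1r.
rewrite (@ge0_continuous_FTC2y _ _ (fun s => - a^-1 * expR (- a * s)) _ 0)//=.
- by rewrite -EFinB ltry.
- exact: continuous_subspaceT.
- rewrite -(mulr0 (- a^-1)); apply: cvgMr; exact: cvg_expR_decay.
- by apply: cvg_at_right_filter; apply: cvgMr; exact: c.
- by move=> t _; rewrite derive1E; have [] := dF t.
Qed.

Lemma integrable_laplace d b B f : b < d -> measurable_fun [set: R] f ->
  (forall t, 0 <= t -> `|f t| <= B * expR (b * t)) ->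
  mu.-integrable `[0, +oo[ (EFin \o (fun t => expR (- d * t) * f t)).
Proof.
move=> bd mf fB; have db0 : 0 < d - b by rewrite subr_gt0.
apply: (@le_integrable _ _ _ mu _ _ _
    (fun t => B%:E * (EFin \o (fun t => expR (- (d - b) * t))) t)%E) => //.
- apply/measurable_EFinP; apply: measurable_funTS; apply: measurable_funM => //.
  by apply: continuous_measurable_fun; exact: (@continuous_expRM (- d)).
- move=> t /=; rewrite in_itv/= andbT => t0; rewrite lee_fin.
  rewrite normrM ger0_norm ?expR_ge0// (le_trans _ (ler_norm _))//.
  apply: le_trans (ler_wpM2l (expR_ge0 _) (fB _ t0)) _.
  by rewrite mulrCA -expRD -mulrDl opprB addrC.
- by apply: integrableZl => //; exact: integrable_expR_decay.
Qed.

Lemma Rintegral_dominated_cvg (D : set R) (f_ : nat -> R -> R) f g :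
  measurable D -> (forall n, measurable_fun D (f_ n)) -> measurable_fun D f ->
  (forall t, D t -> f_ ^~ t @ \oo --> f t) ->
  mu.-integrable D (EFin \o g) ->
  (forall n t, D t -> `|f_ n t| <= g t) ->
  (\int[mu]_(t in D) f_ n t) @[n --> \oo] --> \int[mu]_(t in D) f t.
Proof.
move=> mD mf_ mf ff ig fg; apply: fine_cvg.
have [|||||fi _] := @dominated_convergence _ _ _ mu D mD
  (fun n => EFin \o f_ n) (EFin \o f) (EFin \o g); last first.
  by rewrite fineK//; exact: integrable_fin_num.
- by apply: aeW => t n Dt; rewrite lee_fin; exact: fg.
- by [].
- by apply: aeW => t Dt; apply: cvg_EFin; [exact: nearW|exact: ff].
- exact/measurable_EFinP.
- by move=> n; apply/measurable_EFinP; exact: mf_.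
Qed.

(** Truncation at integer endpoints reaches the half-line along a sequence, as dominated convergence
    requires, and each truncated integral is within reach of the fundamental theorem of calculus. *)
Lemma cvg_Rintegral_nat f : mu.-integrable `[0, +oo[ (EFin \o f) ->
  (\int[mu]_(t in `[0, n%:R]) f t) @[n --> \oo] -->
    \int[mu]_(t in `[0, +oo[) f t.
Proof.
move=> fi; have mf : measurable_fun (`[0, +oo[ : set R) f.
  by apply/measurable_EFinP; exact: measurable_int fi.
have sub n : `[0, n%:R] `<=` (`[0, +oo[ : set R).
  by move=> t /=; rewrite !in_itv/= => /andP[->].
rewrite (_ : (fun n => _) =
    (fun n => \int[mu]_(t in `[0, +oo[) (f \_ `[0, n%:R]) t)); last first.
  by apply/funext => n; rewrite -Rintegral_mkcondr setIidr.
apply: (@Rintegral_dominated_cvg _ _ _ (fun t => `|f t|)) => //.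
- move=> n; apply/measurable_restrict => //.
  by apply: measurable_funS mf => //; exact: subIsetl.
- move=> t /=; rewrite in_itv/= andbT => t0; apply: cvg_near_cst.
  near=> n; rewrite patchE mem_set//= in_itv/= t0/=.
  by near: n; exact: nbhs_infty_ger.
- exact: integrable_norm.
- move=> n t _ /=; rewrite patchE; case: ifPn => // _.
  by rewrite normr0.
Unshelve. all: by end_near. Qed.

(** Integration by parts: [h] below is the derivative of e^{-dt} y(t), whose boundary term at
    infinity vanishes because [b < d]. *)
Lemma laplace_derive d b B y z : b < d ->
  (forall t, is_derive t (1 : R) y (z t)) -> continuous z ->
  (forall t, 0 <= t -> `|y t| <= B * expR (b * t)) ->
  (forall t, 0 <= t -> `|z t| <= B * expR (b * t)) ->
  d * (\int[mu]_(t in `[0, +oo[) (expR (- d * t) * y t)) =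
    y 0 + \int[mu]_(t in `[0, +oo[) (expR (- d * t) * z t).
Proof.
move=> bd dy cz yB zB.
have cy : continuous y.
  move=> t; apply: differentiable_continuous; apply/derivable1_diffP.
  by have [] := dy t.
have ce := @continuous_expRM (- d).
have iy := integrable_laplace bd (continuous_measurable_fun cy) yB.
have iz := integrable_laplace bd (continuous_measurable_fun cz) zB.
pose h t := expR (- d * t) * z t - d * (expR (- d * t) * y t).
have ch : continuous h.
  by move=> t; apply: cvgB; [|apply: cvgMr]; apply: cvgM; by [exact: ce|exact: cy|exact: cz].
have idy : mu.-integrable `[0, +oo[ (EFin \o (fun t => d * (expR (- d * t) * y t))).
  exact: (integrableZl _ d iy).
have ih : mu.-integrable `[0, +oo[ (EFin \o h).
  exact: (integrableB _ iz idy).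
have dH t : is_derive t (1 : R) (fun s => expR (- d * s) * y s) (h t).
  have := is_deriveM (is_derive_expRM (- d) t) (dy t).
  rewrite (_ : _ + _ = h t)//.
  by rewrite /h /GRing.scale/=; ring.
have ftc (n : nat) : (0 < n)%N -> \int[mu]_(t in `[0, n%:R]) h t =
    expR (- d * n%:R) * y n%:R - y 0.
  move=> n0; rewrite /Rintegral.
  rewrite (@continuous_FTC2 _ h (fun s => expR (- d * s) * y s))//=.
  - by rewrite mulr0 expR0 mul1r.
  - by rewrite ltr0n.
  - exact: continuous_subspaceT.
  - have cH : continuous (fun s => expR (- d * s) * y s).
      by move=> t; apply: cvgM; [exact: ce|exact: cy].
    split; first by move=> t _; have [] := dH t.
      exact/cvg_at_right_filter/cH.
    exact/cvg_at_left_filter/cH.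
  - by move=> t _; rewrite derive1E; have [] := dH t.
have lim0 : (expR (- d * n%:R) * y n%:R) @[n --> \oo] --> (0 : R).
  apply/norm_cvg0P; apply: (@squeeze_cvgr _ _ _ _ (cst 0)
      (fun n : nat => `|B| * expR (- (d - b) * n%:R))).
  - near=> n; rewrite normr_ge0/= normrM ger0_norm ?expR_ge0//.
    apply: le_trans (ler_wpM2l (expR_ge0 _) (yB n%:R _)) _ => //.
    rewrite mulrCA -expRD -mulrDl opprB [- d + b]addrC.
    by rewrite ler_wpM2r ?expR_ge0// ler_norm.
  - exact: cvg_cst.
  - rewrite -(mulr0 `|B|); apply: cvgMr.
    have db0 : 0 < d - b by rewrite subr_gt0.
    exact: (@cvg_comp _ _ _ (fun n : nat => n%:R : R) _ _ _ _
      (@cvgr_idn R) (cvg_expR_decay db0)).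
have := cvg_Rintegral_nat ih.
have : (\int[mu]_(t in `[0, n%:R]) h t) @[n --> \oo] --> - y 0.
  rewrite -[X in _ --> X]add0r.
  apply: cvg_trans; last exact: (cvgB lim0 (cvg_cst (y 0))).
  apply: near_eq_cvg; near=> n; rewrite ftc//.
  by near: n; exact: nbhs_infty_gt.
move=> h1 h2; have : - y 0 = \int[mu]_(t in `[0, +oo[) h t by exact: (cvg_unique _ h1 h2).
rewrite /h RintegralB// RintegralZl// => yE.
by apply/eqP; rewrite -subr_eq0 -(opprK (y 0)) yE; apply/eqP; ring.
Unshelve. all: by end_near. Qed.

End Laplace.

(** * Spectral theorem and matrix exponential *)

Lemma cvg_mx (R : realType) (m n : nat) (T : Type) (F : set_system T)
    (FF : Filter F) (f : T -> 'M[R]_(m, n)) (l : 'M[R]_(m, n)) :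
  (forall i j, (fun x => f x i j) @ F --> l i j) -> f @ F --> l.
Proof.
move=> fl; apply/cvgrPdist_le => /= e e0.
have : \forall x \near F, forall ij : 'I_m * 'I_n,
    `|l ij.1 ij.2 - f x ij.1 ij.2| <= e.
  by apply: filter_forall => ij; exact: ((cvgrPdist_le _ _).1 (fl ij.1 ij.2)).
apply: filterS => x fle.
rewrite /Num.Def.normr/= mx_normrE (bigmax_le _ (ltW e0))//= => -[i j] _.
by rewrite !mxE; exact: (fle (i, j)).
Qed.

Section Spectral.
Variables (R : realType) (N : nat).
Implicit Types (A P : 'M[R]_N) (d : 'rV[R]_N).

(** The complexification is Hermitian, hence diagonalisable with real spectrum; [real_similar] then
    replaces the complex conjugating matrix by a real invertible one. *)
Lemma symmetric_diagonalizable A : A^T = A ->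
  exists P d, P \in unitmx /\ A = invmx P *m diag_mx d *m P.
Proof.
move=> symA; set toC := real_complex R; pose B := map_mx toC A.
have Breal : B \is a mxOver Num.real.
  by apply/mxOverP => i j; rewrite mxE; apply/complex_realP; exists (A i j).
have Bherm : B \is hermsymmx.
  apply/is_hermitianmxP; rewrite expr0 scale1r; apply/matrixP => i j.
  rewrite !mxE -[in RHS]symA mxE; apply/esym/CrealP.
  by apply/complex_realP; exists (A i j).
have := hermitian_spectral_diag_real Bherm.
have /hermitian_normalmx/orthomx_spectralP := Bherm.
set Q := spectralmx B; set D := spectral_diag B => BE Dreal.
have Qu : Q \in unitmx := spectral_unit B.
have [P0 /andP[P0real P0u] P0B] : exists2 P0 : 'M[R[i]]_N,
    P0 \in [predI mxOver Num.real & unitmx] & similar P0 B (diag_mx D).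
  apply: real_similar => //.
    exists Q => //; apply/similarP => //.
    by rewrite {1}BE !mulmxA mulmxV// mul1mx.
  apply/mxOverP => i j; rewrite !mxE; case: (i == j); rewrite ?mulr1n ?mulr0n//.
  by have /mxOverP := Dreal; apply.
pose P := map_mx (@complex.Re R) P0; pose d := map_mx (@complex.Re R) D.
have P0E : P0 = map_mx toC P.
  apply/matrixP => i j; rewrite !mxE/= /toC RRe_real//.
  by have /mxOverP := P0real; apply.
have DE : D = map_mx toC d.
  apply/matrixP => i j; rewrite !mxE/= /toC RRe_real//.
  by have /mxOverP := Dreal; apply.
have Pu : P \in unitmx by move: P0u; rewrite P0E map_unitmx.
exists P, d; split => //.
have := similarP P0u P0B; rewrite P0E DE -map_diag_mx /B -!map_mxM => h.
by rewrite -mulmxA -(map_mx_inj h) mulKmx.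
Qed.

Lemma exprn_conj_diag P d k : P \in unitmx ->
  (invmx P *m diag_mx d *m P) ^+ k =
    invmx P *m diag_mx (map_mx (fun x => x ^+ k) d) *m P.
Proof.
move=> Pu; elim: k => [|k IH].
  rewrite expr0 (_ : diag_mx _ = 1%:M) ?mulmx1 ?mulVmx//.
  by apply/matrixP => i j; rewrite !mxE expr0.
rewrite exprS IH -[_ * _]/(_ *m _) !mulmxA mulmxK// -[_ *m _ *m diag_mx _]mulmxA.
congr (_ *m _ *m _); rewrite mulmx_diag; congr diag_mx.
by apply/rowP => i; rewrite !mxE exprS.
Qed.

Lemma expmx_conj_diag P d : P \in unitmx ->
  expmx (invmx P *m diag_mx d *m P) =
    invmx P *m diag_mx (map_mx expR d) *m P.
Proof.
move=> Pu; rewrite /expmx; apply: cvg_lim; first exact: norm_hausdorff.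
rewrite (_ : series _ = fun n => invmx P *m
   diag_mx (\row_i series (exp_coeff (d 0 i)) n) *m P); last first.
  apply/funext => n; rewrite seriesEnat /=.
  under eq_bigr do rewrite exprn_conj_diag// scalemxAl scalemxAr.
  rewrite -mulmx_suml -mulmx_sumr; congr (_ *m _ *m _).
  apply/matrixP => i j; rewrite summxE !mxE seriesEnat/= -sumrMnl.
  by apply: eq_bigr => k _; rewrite !mxE /exp_coeff mulrnAr mulrC.
apply: cvg_mx => i j.
rewrite (_ : (fun n => _) = (fun n => \sum_k (invmx P i k *
    series (exp_coeff (d 0 k)) n * P k j))); last first.
  by apply/funext => n; rewrite mul_mx_diag mxE; apply: eq_bigr => k _; rewrite !mxE.
rewrite (_ : (_ *m _ *m _) i j = \sum_k (invmx P i k * expR (d 0 k) * P k j)).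
  apply: cvg_big => [|k _]; first exact: add_continuous.
  by apply: cvgMl; apply: cvgMr; exact: is_cvg_series_exp_coeff.
by rewrite mul_mx_diag mxE; apply: eq_bigr => k _; rewrite !mxE.
Qed.

Lemma diag_eigenvalue P d j : P \in unitmx ->
  eigenvalue (invmx P *m diag_mx d *m P) (d 0 j).
Proof.
move=> Pu; apply/eigenvalueP; exists (row j P).
  rewrite !mulmxA -row_mul mulmxV// -[row j 1%:M *m _]row_mul mul1mx.
  by apply/rowP => i; rewrite -row_mul mul_diag_mx !mxE.
apply: contraTneq Pu => rP0; rewrite unitmxE.
rewrite (expand_det_row _ j) big1 ?unitr0// => i _.
by have /rowP/(_ i) := rP0; rewrite !mxE => ->; rewrite mul0r.
Qed.

Lemma posdef_eigenvalue_gt0 A a : posdefmx A -> eigenvalue A a -> 0 < a.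
Proof.
move=> Apd /eigenvalueP[v vA v0]; have := Apd _ v0; rewrite vA -scalemxAl mxE.
have : 0 <= (v *m v^T) 0 0.
  by rewrite mxE sumr_ge0// => i _; rewrite mxE -expr2 sqr_ge0.
rewrite le_eqVlt => /orP[/eqP <-|vv0]; first by rewrite mulr0 ltxx.
by rewrite pmulr_lgt0.
Qed.

End Spectral.

(** * Reduction of the generalised synchronisation to scalar transforms *)

Definition flow_laplace (R : realType) (q : nat) (M : manifold R q)
    (phi : R -> M -> M) (w : M -> R) (d : R) (m : M) : R :=
  \int[lebesgue_measure]_(t in `[0, +oo[) (expR (- d * t) * w (phi (- t) m)).

Lemma Rintegral_sum (R : realType) (I : finType) (D : set R) (f : I -> R -> R) :
  measurable D ->
  (forall i, (@lebesgue_measure R).-integrable D (EFin \o f i)) ->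
  \int[lebesgue_measure]_(t in D) (\sum_i f i t) =
  \sum_i \int[lebesgue_measure]_(t in D) f i t.
Proof.
move=> mD fi; rewrite /Rintegral.
under eq_integral do rewrite -sumEFin.
rewrite integral_sum//= -sum_fine// => i _.
by apply: integrable_fin_num => //; exact: fi.
Qed.

Lemma gen_sync_conj_diag (R : realType) (q N : nat) (M : manifold R q)
    (P : 'M[R]_N) (d : 'rV[R]_N) (C : 'cV[R]_N) (phi : R -> M -> M)
    (w : M -> R) (m : M) : P \in unitmx ->
  (forall j, (@lebesgue_measure R).-integrable `[0, +oo[
     (EFin \o (fun t => expR (- d 0 j * t) * w (phi (- t) m)))) ->
  gen_sync (invmx P *m diag_mx d *m P) C phi w m =
    invmx P *m \col_j ((P *m C) j 0 * flow_laplace phi w (d 0 j) m).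
Proof.
move=> Pu fi; apply/colP => i; rewrite !mxE.
have -> : (fun t => (expmx (- (t *: (invmx P *m diag_mx d *m P))) *m C) i 0 *
      w (phi (- t) m)) = (fun t => \sum_j (invmx P i j * (P *m C) j 0) *
      (expR (- d 0 j * t) * w (phi (- t) m))).
  apply/funext => t.
  have -> : - (t *: (invmx P *m diag_mx d *m P)) =
      invmx P *m diag_mx (- t *: d) *m P.
    have -> : diag_mx (- t *: d) = - t *: diag_mx d by rewrite linearZ.
    by rewrite -scalemxAr -scalemxAl scaleNr.
  rewrite expmx_conj_diag// -[_ *m P *m C]mulmxA mul_mx_diag mxE mulr_suml.
  apply: eq_bigr => j _; rewrite !mxE mulNr (mulrC t) -mulNr.
  by rewrite -!mulrA; congr (_ * _); rewrite mulrCA.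
rewrite Rintegral_sum//=; last first.
  by move=> j; exact: (integrableZl _ _ (fi j)).
by apply: eq_bigr => j _; rewrite RintegralZl// !mxE mulrA.
Qed.

(** * Sylvester relations and linear independence *)

Section Sylvester.
Variables (R : realType) (q N : nat).
Local Notation toC := (real_complex R).

Lemma addmx_scalar_conj_diag (F : fieldType) (P : 'M[F]_N) (d : 'rV[F]_N) a :
  P \in unitmx ->
  invmx P *m diag_mx d *m P + a%:M = invmx P *m diag_mx (d + const_mx a) *m P.
Proof.
move=> Pu; rewrite linearD/= diag_const_mx mulmxDr mulmxDl; congr (_ + _).
by rewrite mul_mx_scalar -scalemxAl mulVmx// scalemx1.
Qed.

Lemma invmx_conj_diag (F : fieldType) (P : 'M[F]_N) (d : 'rV[F]_N) :
  P \in unitmx -> (forall i, d 0 i != 0) ->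
  invmx (invmx P *m diag_mx d *m P) =
  invmx P *m diag_mx (map_mx GRing.inv d) *m P.
Proof.
move=> Pu d0; set B := RHS.
have AB : (invmx P *m diag_mx d *m P) *m B = 1%:M.
  rewrite /B !mulmxA mulmxK// -(mulmxA (invmx P)) mulmx_diag.
  rewrite (_ : diag_mx _ = 1%:M) ?mulmx1 ?mulVmx//.
  by apply/matrixP => i j; rewrite !mxE mulfV.
have /mulmx1_unit[Au _] := AB.
by rewrite -[LHS]mulmx1 -AB mulKmx.
Qed.

Lemma eigenvector_of_spectrum (J : 'M[R]_q) (lam : 'I_q -> R[i]) j :
  are_eigenvalues J lam ->
  exists2 v : 'rV[R[i]]_q, v *m map_mx toC J = lam j *: v & v != 0.
Proof.
move=> Jlam; apply/eigenvalueP; rewrite eigenvalue_root_char Jlam.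
by rewrite (bigD1 j)//= rootM root_XsubC eqxx.
Qed.

(* Pairing the Sylvester relation [d i * l i + J l i = p] with an eigenvector
   [v j] of [J] gives [(d i + lam j) (v j . l i) = v j . p]. *)
Lemma sylvester_row_free (P : 'M[R]_N) (d : 'rV[R]_N) (C : 'cV[R]_N)
    (J : 'M[R]_q) (p : 'cV[R]_q) (l : 'I_N -> 'cV[R]_q)
    (lam : 'I_q -> R[i]) (v : 'I_q -> 'rV[R[i]]_q) : P \in unitmx ->
  (forall i, d 0 i *: l i + J *m l i = p) ->
  (forall j, v j *m map_mx toC J = lam j *: v j) ->
  (forall j, v j *m map_mx toC p != 0) ->
  free [seq invmx (map_mx toC (invmx P *m diag_mx d *m P) + (lam j)%:M)
            *m map_mx toC C | j : 'I_q] ->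
  row_free (\matrix_(a < q, i < N) ((P *m C) i 0 * l i a 0)).
Proof.
move=> Pu dl vJ vp fr; set L := \matrix_(a, i) _.
have PCu : map_mx toC P \in unitmx by rewrite map_unitmx.
have key i j : (toC (d 0 i) + lam j) * (v j *m map_mx toC (l i)) 0 0 =
    (v j *m map_mx toC p) 0 0.
  rewrite -(dl i) map_mxD map_mxM map_mxZ mulmxDr mulmxA vJ.
  by rewrite -scalemxAr -scalemxAl !mxE mulrDl.
have vp0 j : (v j *m map_mx toC p) 0 0 != 0.
  apply: contraNneq (vp j) => h; apply/eqP/matrixP => a b.
  by rewrite !ord1 h mxE.
(* Invertibility of [A + lam j] is read off [key], whose right-hand side is nonzero. *)
have dlam0 i j : toC (d 0 i) + lam j != 0.
  by apply: contraNneq (vp0 j) => h; rewrite -(key i) h mul0r.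
pose x j := invmx (map_mx toC (invmx P *m diag_mx d *m P) + (lam j)%:M)
            *m map_mx toC C.
have xE j : x j = invmx (map_mx toC P) *m
    \col_i ((toC (d 0 i) + lam j)^-1 * toC ((P *m C) i 0)).
  rewrite /x !map_mxM map_invmx map_diag_mx addmx_scalar_conj_diag//.
  rewrite invmx_conj_diag; [|by []|by move=> i; rewrite !mxE; exact: dlam0].
  rewrite -!mulmxA; congr (_ *m _); rewrite -map_mxM.
  by apply/colP => i; rewrite mul_diag_mx !mxE.
have vL j : v j *m map_mx toC L =
    (v j *m map_mx toC p) 0 0 *: (map_mx toC P *m x j)^T.
  apply/rowP => i; rewrite xE mulKVmx//.
  transitivity (toC ((P *m C) i 0) * (v j *m map_mx toC (l i)) 0 0).
    rewrite mxE [(_ *m map_mx _ (l i)) 0 0]mxE mulr_sumr; apply: eq_bigr => a _.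
    rewrite [(map_mx _ (l i)) _ _]mxE [(map_mx _ L) a i]mxE [L a i]mxE mulrCA.
    by congr (_ * _); exact: rmorphM.
  move: (key i j); set vl := (_ *m _) 0 0 => <-.
  rewrite [RHS]mxE [(_^T) _ _]mxE [(\col__ _) _ _]mxE.
  by rewrite mulrACA mulfV// mul1r mulrC.
have free_x : forall k : 'I_q -> R[i], \sum_j k j *: x j = 0 -> forall j, k j = 0.
  have : free [tuple x j | j < q].
    exact: fr.
  move=> /freeP h k k0; apply: h; rewrite -[RHS]k0; apply: eq_bigr => j _.
  by rewrite -tnth_nth tnth_mktuple.
rewrite /row_free -(mxrank_map toC) eqn_leq rank_leq_row/=.
(* The rank of [W *m L] is at most that of [L]. By [vL] its rows are nonzero multiples of the images
   under [P] of the independent vectors [x j], so it is already [q]. *)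
pose W : 'M[R[i]]_q := \matrix_j v j.
apply: leq_trans (mxrankM_maxr W _); rewrite row_leq_rank -kermx_eq0.
apply/rowV0P => u /sub_kermxP uWL.
apply/rowP => j; rewrite mxE; apply/eqP.
have := free_x (fun j => u 0 j * (v j *m map_mx toC p) 0 0).
move=> /(_ _ j)/= h; have /eqP : u 0 j * (v j *m map_mx toC p) 0 0 = 0.
  apply: h; apply: (can_inj (mulKmx PCu)); rewrite mulmx0.
  apply: trmx_inj; rewrite trmx0 -[RHS]uWL mulmx_sum_row.
  rewrite mulmx_sumr linear_sum/=; apply: eq_bigr => k _.
  rewrite row_mul rowK vL -scalemxAr linearZ/=.
  by rewrite scalerA.
by rewrite mulf_eq0 (negbTE (vp0 j)) orbF.
Qed.

End Sylvester.

(** * Differential calculus in normed spaces *)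

Section Differentials.
Variable R : realType.

Lemma differentiable_littleo (V W : normedModType R) (f : V -> W)
    (df : {linear V -> W}) (x : V) : continuous df ->
  (forall e, 0 < e -> \forall h \near (0 : V),
     `|f (h + x) - f x - df h| <= e * `|h|) ->
  differentiable f x /\ 'd f x = df :> (V -> W).
Proof.
move=> cdf fo.
have fE : f \o shift x = cst (f x) + df +o_ (0 : V) id.
  apply/eqaddoP => e e0; have := fo e e0; apply: filterS => h.
  by rewrite /= !fctE opprD addrA.
have dE : 'd f x = df :> (V -> W) := diff_unique cdf fE.
by split => //; apply/diff_locallyP; rewrite dE.
Qed.

Lemma differentiable_approx (V W : normedModType R) (f : V -> W) (x : V) :
  differentiable f x -> forall e, 0 < e -> \forall h \near (0 : V),
    `|f (h + x) - f x - 'd f x h| <= e * `|h|.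
Proof.
move=> /diff_locally/eqaddoP fo e e0; have := fo e e0; apply: filterS => h.
by rewrite /= !fctE opprD addrA.
Qed.

Lemma near_eq_diff (V W : normedModType R) (f g : V -> W) (x : V) :
  {near x, f =1 g} -> differentiable g x ->
  differentiable f x /\ 'd f x = 'd g x :> (V -> W).
Proof.
move=> fg dg; apply: differentiable_littleo; first exact: diff_continuous.
move=> e e0; have fg0 : \forall h \near (0 : V), f (h + x) = g (h + x).
  have cx : (fun h : V => h + x) @ (0 : V) --> x.
    by rewrite -[X in _ --> X](add0r x); apply: cvgD; [exact: cvg_id|exact: cvg_cst].
  exact: (cx _ fg).
near=> h; rewrite (near fg0 h)// (nbhs_singleton fg).
by near: h; exact: differentiable_approx.
Unshelve. all: by end_near. Qed.

Lemma is_derive_comp_diff (V W : normedModType R) (c : R -> V) (f : V -> W)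
    (s : R) (v : V) : is_derive s (1 : R) c v -> differentiable f (c s) ->
  is_derive s (1 : R) (f \o c) ('d f (c s) v).
Proof.
move=> [/derivable1_diffP dc <-] df.
have dfc : differentiable (f \o c) s by exact: differentiable_comp.
split; first exact/derivable1_diffP.
by rewrite !deriveE// diff_comp.
Qed.

Lemma is_derive_line (V : normedModType R) (x v : V) (s : R) :
  is_derive s (1 : R) (fun s => s *: v + x) v.
Proof.
have dl : is_derive s (1 : R) ( *:%R^~ v) v.
  have d : differentiable ( *:%R^~ v : R -> V) s by exact: ex_diff.
  split; first exact/derivable1_diffP.
  by rewrite deriveE// diff_val scale1r.
have := is_deriveD dl (is_derive_cst x s 1); by rewrite addr0.
Qed.

(** The one-variable mean value theorem along the segment from [x0] to [x], which stays in the ball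
    by convexity. *)
Lemma diff_ball_lipschitz (V : normedModType R) (f : V -> R) (x0 : V) (r B : R) :
  (forall x, ball x0 r x ->
     differentiable f x /\ forall h, `|'d f x h| <= B * `|h|) ->
  forall x, ball x0 r x -> `|f x - f x0| <= B * `|x - x0|.
Proof.
move=> df x x0x; pose c (s : R) := s *: (x - x0) + x0.
have cb (s : R) : s \in `[0, 1] -> ball x0 r (c s).
  rewrite in_itv/= => /andP[s0 s1]; move: x0x; rewrite -!ball_normE/= /c.
  rewrite opprD addrCA subrr addr0 normrN normrZ ger0_norm// distrC.
  by apply: le_lt_trans; rewrite ler_piMl.
have dfc (s : R) : s \in `[0, 1] ->
    is_derive s (1 : R) (f \o c) ('d f (c s) (x - x0)).
  move=> /cb/df[? _]; apply: is_derive_comp_diff => //; exact: is_derive_line.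
pose F := f \o c; pose dF (s : R) : R := 'd f (c s) (x - x0).
have dFF (s : R) : s \in `]0, 1[ -> is_derive s (1 : R) F (dF s).
  by move=> s01; apply: dfc; exact: subset_itv_oo_cc s01.
have cF : {within `[0, 1], continuous F}.
  by apply: derivable_within_continuous => s s01; have [] := dfc s s01.
have [s s01] := MVT ltr01 dFF cF.
rewrite /F /= /c scale1r subrK scale0r add0r subr0 mulr1 => ->.
by have [_] := df _ (cb s (subset_itv_oo_cc s01)); apply.
Qed.

End Differentials.

(** * Positive definite quadratic forms *)

Section Gram.
Variables (R : realType) (q : nat).
Implicit Types (G : 'M[R]_q) (v w : 'rV[R]_q).

Definition qform G v : R := (v *m G *m v^T) 0 0.

Lemma normr_entry (m n : nat) (B : 'M[R]_(m, n)) i j : `|B i j| <= `|B|.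
Proof.
rewrite [leRHS]/Num.Def.normr/= mx_normrE.
exact: (le_bigmax _ (fun ij => `|B ij.1 ij.2|) (i, j)).
Qed.

Lemma normr_mx_le (m n : nat) (B : 'M[R]_(m, n)) (b : R) : 0 <= b ->
  (forall i j, `|B i j| <= b) -> `|B| <= b.
Proof.
move=> b0 Bb; rewrite [leLHS]/Num.Def.normr/= mx_normrE.
by apply: bigmax_le => // ij _.
Qed.

Lemma qform_le G v : `|qform G v| <= (q * q)%:R * `|G| * `|v| ^+ 2.
Proof.
rewrite /qform mxE; apply: le_trans (ler_norm_sum _ _ _) _.
have b (j : 'I_q) : `|(v *m G) 0 j * v^T j 0| <= q%:R * `|G| * `|v| ^+ 2.
  rewrite normrM !mxE expr2 mulrA ler_pM ?normr_entry//.
  apply: le_trans (ler_norm_sum _ _ _) _.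
  apply: le_trans (ler_sum _ (G := fun _ => `|G| * `|v|) _) _.
    by move=> i _; rewrite normrM mulrC ler_pM ?normr_entry.
  by rewrite sumr_const card_ord -mulrA mulr_natl.
apply: le_trans (ler_sum _ (fun j _ => b j)) _.
by rewrite sumr_const card_ord natrM -[leLHS]mulr_natl !mulrA.
Qed.

(* The minimum of [s |-> qform G (v - s w)], for [w] the row of [G^-1] dual to
   the [i]-th basis vector, is nonnegative. *)
Lemma posdef_coercive G : G^T = G -> posdefmx G ->
  exists2 k : R, 0 < k & forall v, k * `|v| ^+ 2 <= qform G v.
Proof.
move=> symG pG.
have Gu : G \in unitmx.
  rewrite -row_free_unit -kermx_eq0; apply/rowV0P => v /sub_kermxP vG.
  by apply/eqP/negPn/negP => /pG; rewrite vG mul0mx mxE ltxx.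
pose w i := row i (invmx G).
have wG i : w i *m G = delta_mx 0 i by rewrite -row_mul mulVmx// rowE mulmx1.
have w0 i : w i != 0.
  apply/eqP => wi; have := wG i; rewrite wi mul0mx => /rowP/(_ i).
  by rewrite !mxE !eqxx => /eqP; rewrite eq_sym oner_eq0.
have wGv i v : (w i *m G *m v^T) 0 0 = v 0 i by rewrite wG -rowE !mxE.
have vGw i v : (v *m G *m (w i)^T) 0 0 = v 0 i.
  have tr00 (B : 'M[R]_1) : B 0 0 = B^T 0 0 by rewrite mxE.
  by rewrite tr00 !trmx_mul trmxK symG mulmxA wGv.
have qw0 i : 0 < qform G (w i) by exact: pG.
have qge0 v : 0 <= qform G v.
  have [->|v0] := eqVneq v 0; first by rewrite /qform !mul0mx mxE.
  by rewrite ltW// pG.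
(* Cauchy-Schwarz for [v] and [w i], whose [G]-pairing is the coordinate [v 0 i]. *)
have vi i v : (v 0 i) ^+ 2 <= qform G (w i) * qform G v.
  have qE (s : R) : qform G (v - s *: w i) =
      qform G v - s * v 0 i *+ 2 + s ^+ 2 * qform G (w i).
    rewrite /qform.
    have -> : (v - s *: w i)^T = v^T - s *: (w i)^T by rewrite linearB/= linearZ.
    rewrite mulmxBr !mulmxBl -!scalemxAr -!scalemxAl.
    move: (wGv i v) (vGw i v).
    move: (w i *m G *m v^T) (v *m G *m (w i)^T) (v *m G *m v^T)
      (w i *m G *m (w i)^T) => a b c e ai bi; rewrite !mxE ai bi; ring.
  have := qge0 (v - (v 0 i / qform G (w i)) *: w i); rewrite qE.
  move: (qw0 i); move: (qform G (w i)) (qform G v) (v 0 i) => a b x a0 h.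
  rewrite -subr_ge0 (_ : _ - _ =
    a * (b - x / a * x *+ 2 + (x / a) ^+ 2 * a)); first by rewrite mulr_ge0// ltW.
  by field; rewrite gt_eqF.
(* [T] dominates every [qform G (w i)]; the summand 1 keeps it positive even for [q = 0]. *)
pose T := \sum_i qform G (w i) + 1.
have T0 : 0 < T by rewrite ltr_wpDl// sumr_ge0.
exists T^-1; first by rewrite invr_gt0.
move=> v; rewrite ler_pdivrMl//.
have Tq0 : 0 <= T * qform G v by rewrite mulr_ge0// ltW.
rewrite -[leRHS]sqr_sqrtr// ler_sqr ?nnegrE ?sqrtr_ge0//.
apply: normr_mx_le; first exact: sqrtr_ge0.
move=> a i; rewrite ord1 -sqrtr_sqr ler_wsqrtr// (le_trans (vi i v))//.
rewrite ler_wpM2r// /T (bigD1 i)//= -addrA lerDl addr_ge0//.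
exact: sumr_ge0.
Qed.

End Gram.

(** * Differentials through charts *)

Section Charts.
Variables (R : realType) (q : nat) (M : manifold R q).
Implicit Types (m : M) (a b : chart R q M).

Lemma base_coord_img m : cimg (chart_at m) (base_coord m).
Proof. by exists m => //; exact: chart_at_dom. Qed.

Lemma base_coordK m : cinv (chart_at m) (base_coord m) = m.
Proof. by rewrite cmapK//; exact: chart_at_dom. Qed.

Lemma cinvK a x : cimg a x -> cmap a (cinv a x) = x.
Proof. by move=> [m am <-]; rewrite cmapK. Qed.

Lemma cdom_cinv a x : cimg a x -> cdom a (cinv a x).
Proof. by move=> [m am <-]; rewrite cmapK. Qed.

Lemma chart_near (T : topologicalType) (u : T -> M) x b :
  {for x, continuous u} -> cdom b (u x) -> \forall y \near x, cdom b (u y).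
Proof.
move=> cu bux; apply: cu; apply: open_nbhs_nbhs; split => //.
exact: cdom_open.
Qed.

(** Since [cinv b] inverts [cmap b] only on [cdom b], the factorisation of [f \o u] through the
    chart [b] holds only near [x]; continuity of [u] supplies the neighbourhood. *)
Lemma chart_chain (E W : normedModType R) (u : E -> M) (f : M -> W) x b :
  {for x, continuous u} -> cdom b (u x) ->
  differentiable (cmap b \o u) x ->
  differentiable (f \o cinv b) (cmap b (u x)) ->
  differentiable (f \o u) x /\ forall h, 'd (f \o u) x h =
    'd (f \o cinv b) (cmap b (u x)) ('d (cmap b \o u) x h).
Proof.
move=> cu bux du df.
have [] := @near_eq_diff R E W (f \o u) ((f \o cinv b) \o (cmap b \o u)) x.
- have := chart_near cu bux; apply: filterS => y by_ /=.
  by rewrite cmapK.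
- exact: differentiable_comp.
- by move=> dfu dE; split => // h; rewrite (congr1 (@^~ h) dE) diff_comp.
Qed.

Lemma transition_differentiable a b x : atlas a -> atlas b ->
  cimg a x -> cdom b (cinv a x) -> differentiable (cmap b \o cinv a) x.
Proof.
move=> aa ab ax bx; have [+ _] := atlas_smooth aa ab 1; apply.
by exists (cinv a x); rewrite ?cinvK//; split => //; exact: cdom_cinv.
Qed.

Lemma cinv_cont a x : cimg a x -> {for x, continuous (cinv a)}.
Proof. exact: cinv_continuous. Qed.

Lemma diff_change_chart (W : normedModType R) (f : M -> W) a b x :
  atlas a -> atlas b -> cimg a x -> cdom b (cinv a x) ->
  differentiable (f \o cinv b) (cmap b (cinv a x)) ->
  differentiable (f \o cinv a) x /\ forall h, 'd (f \o cinv a) x h =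
    'd (f \o cinv b) (cmap b (cinv a x)) ('d (cmap b \o cinv a) x h).
Proof.
move=> aa ab ax bx df.
exact: (chart_chain (cinv_cont ax) bx
  (transition_differentiable aa ab ax bx) df).
Qed.

(* [frame a x] converts the coordinates in the chart [a] of a tangent vector at
   [cinv a x] into its coordinates in the preferred chart. *)
Definition frame a x : 'rV[R]_q -> 'rV[R]_q :=
  'd (cmap (chart_at (cinv a x)) \o cinv a) x.

Lemma diff_C1_fun (w : M -> R) a x : C1_fun w -> atlas a -> cimg a x ->
  differentiable (w \o cinv a) x /\
  forall h, 'd (w \o cinv a) x h = tdiff w (cinv a x) (frame a x h).
Proof.
move=> w1 aa ax; have ba := chart_at_atlas (cinv a x).
apply: diff_change_chart => //; first exact: chart_at_dom.
by have [+ _] := w1 _ ba; apply; exact: base_coord_img.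
Qed.

(** The chain rule, once through the preferred chart at [cinv a x] and once through the one at its
    image. As [w] is scalar, the second chart cancels between [tdiff] and [tmap], so the image may
    lie anywhere in [M]. *)
Lemma diff_C1_map (psi : M -> M) (w : M -> R) a x :
  C1_map psi -> C1_fun w -> atlas a -> cimg a x ->
  differentiable (w \o psi \o cinv a) x /\
  forall h, 'd (w \o psi \o cinv a) x h =
    tdiff w (psi (cinv a x)) (tmap psi (cinv a x) (frame a x h)).
Proof.
move=> [cpsi psi1] w1 aa ax; set m := cinv a x.
pose b1 := chart_at m; pose b2 := chart_at (psi m).
have dpsi : differentiable (cmap b2 \o psi \o cinv b1) (cmap b1 m).
  have [+ _] := psi1 b1 b2 (chart_at_atlas _) (chart_at_atlas _); apply.
  by exists m => //; split; exact: chart_at_dom.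
have [dpa dpaE] := diff_change_chart aa (chart_at_atlas m) ax
  (chart_at_dom m) dpsi.
have [||||dwp dwpE] := @chart_chain _ _ (psi \o cinv a) w x b2.
- by apply: continuous_comp; [exact: cinv_cont|exact: cpsi].
- exact: chart_at_dom.
- exact: dpa.
- by have [+ _] := w1 _ (chart_at_atlas (psi m)); apply; exact: base_coord_img.
split; [exact: dwp|move=> h].
exact: (etrans (dwpE h) (congr1 _ (dpaE h))).
Qed.

Lemma frame_base m h : frame (chart_at m) (base_coord m) h = h.
Proof.
rewrite /frame base_coordK.
have [||_ ->] := @near_eq_diff R _ _ (cmap (chart_at m) \o cinv (chart_at m)) id
  (base_coord m).
- have : \forall y \near base_coord m, cimg (chart_at m) y.
    apply: open_nbhs_nbhs; split; first exact: cimg_open.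
    exact: base_coord_img.
  by apply: filterS => y /cinvK.
- exact: ex_diff.
- by rewrite diff_val.
Qed.

End Charts.

(** * Riemannian norm against coordinate norm *)

Lemma lty_real_ub (R : realType) (x : \bar R) : (x < +oo)%E ->
  exists2 S : R, 0 <= S & (x <= S%:E)%E.
Proof.
case: x => [r _| |_]; last 2 first.
- by rewrite ltxx.
- by exists 0 => //; exact: leNye.
by exists `|r|; rewrite ?lee_fin ?ler_norm.
Qed.

Lemma qformB (R : realType) (q : nat) (G G' : 'M[R]_q) h :
  qform (G - G') h = qform G h - qform G' h.
Proof. by rewrite /qform mulmxBr mulmxBl [LHS]mxE [X in _ + X]mxE. Qed.

Lemma qform_perturb (R : realType) (q : nat) (G0 : 'M[R]_q) (k : R) : 0 < k ->
  (forall h, k * `|h| ^+ 2 <= qform G0 h) ->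
  exists L d : R, [/\ 0 < L, 0 < d & forall G, `|G - G0| < d ->
    forall h, k / 2 * `|h| ^+ 2 <= qform G h <= L * `|h| ^+ 2].
Proof.
move=> k0 kG; pose c : R := (q * q)%:R + 1.
have c0 : 0 < c by rewrite ltr_wpDl.
have qd (B : 'M[R]_q) (e : R) h : `|B| <= e -> `|qform B h| <= c * e * `|h| ^+ 2.
  move=> Be; apply: le_trans (qform_le B h) _.
  by rewrite ler_wpM2r ?sqr_ge0// ler_pM// lerDl.
(* The second bound gives [c * d <= k / 2], so at most half of the coercivity is lost; the bound by
   1 gives [|G| <= |G0| + 1], whence the upper constant. *)
pose d := Num.min 1 (k / (2 * c)).
exists (c * (`|G0| + 1)), d; split.
- by rewrite mulr_gt0// ltr_wpDl.
- by rewrite lt_min ltr01 divr_gt0// mulr_gt0.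
move=> G Gd h; have [d1 d2] : d <= 1 /\ c * d <= k / 2.
  split; first by rewrite ge_min lexx.
  apply: le_trans (_ : c * (k / (2 * c)) <= _).
    by rewrite ler_pM2l// ge_min lexx orbT.
  by rewrite le_eqVlt; apply/orP; left; apply/eqP; field; rewrite gt_eqF.
apply/andP; split.
- have := qd _ _ h (ltW Gd); rewrite qformB ler_norml => /andP[+ _].
  move: (kG h) (sqr_ge0 `|h|) d2.
  move: (qform G h) (qform G0 h) (`|h| ^+ 2) (c * d) => A B C D; nra.
- apply: le_trans (ler_norm _) _; apply: qd.
  rewrite -(subrK G0 G) (le_trans (ler_normD _ _))// addrC lerD2l.
  by rewrite (le_trans (ltW Gd)).
Qed.

Section TangentNorm.
Variables (R : realType) (q : nat) (M : manifold R q) (g : riemannian M).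
Implicit Types (m : M) (v h : 'rV[R]_q) (a : chart R q M).

Lemma tangent_normZ m (c : R) v :
  tangent_norm g m (c *: v) = `|c| * tangent_norm g m v.
Proof.
rewrite /tangent_norm linearZ/= -!scalemxAl -!scalemxAr scalerA mxE.
by rewrite -expr2 sqrtrM ?sqr_ge0// sqrtr_sqr.
Qed.

Lemma tangent_norm_gt0 m v : v != 0 -> 0 < tangent_norm g m v.
Proof. by move=> v0; rewrite sqrtr_gt0; exact: gram_posdef. Qed.

(** Operator norms are suprema over the unit ball; normalising [v] turns them into pointwise
    inequalities, with the zero vector treated apart. *)
Lemma tangent_norm_ub m (F : 'rV[R]_q -> R) (T : R) :
  (forall (c : R) v, 0 <= c -> F (c *: v) = c * F v) ->
  (forall v, tangent_norm g m v <= 1 -> F v <= T) ->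
  forall v, F v <= T * tangent_norm g m v.
Proof.
move=> FZ FT v; have [->|v0] := eqVneq v 0.
  have -> : tangent_norm g m 0 = 0 by rewrite /tangent_norm !mul0mx mxE sqrtr0.
  by rewrite -(scale0r 0) FZ// mul0r mulr0.
have n0 := tangent_norm_gt0 m v0; set n := tangent_norm g m v in n0 *.
have ni0 : 0 <= n^-1 by rewrite invr_ge0 ltW.
have := FT (n^-1 *: v).
rewrite tangent_normZ FZ// ger0_norm// mulVf ?gt_eqF// => /(_ (lexx _)).
by rewrite ler_pdivrMl// mulrC.
Qed.

Lemma tdiff_le (w : M -> R) (S : R) m v : (tdiff_norm g w m <= S%:E)%E ->
  `|tdiff w m v| <= S * tangent_norm g m v.
Proof.
move=> wS; apply: (tangent_norm_ub (F := fun v => `|tdiff w m v|)).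
  by move=> c u c0; rewrite /tdiff linearZ normrZ ger0_norm.
move=> u u1; rewrite -lee_fin (le_trans _ wS)//; apply: ereal_sup_ubound.
by exists u.
Qed.

Lemma tmap_le (psi : M -> M) (T : R) m v : (tmap_norm g psi m <= T%:E)%E ->
  tangent_norm g (psi m) (tmap psi m v) <= T * tangent_norm g m v.
Proof.
move=> wT; apply: (tangent_norm_ub
    (F := fun v => tangent_norm g (psi m) (tmap psi m v))).
  by move=> c u c0; rewrite /tmap linearZ tangent_normZ ger0_norm.
move=> u u1; rewrite -lee_fin (le_trans _ wT)//; apply: ereal_sup_ubound.
by exists u.
Qed.

(** The metric in the coordinates of the chart [a]; this is the function whose smoothness
    [gram_smooth] asserts. *)
Definition gram_in a (x : 'rV[R]_q) : 'M[R]_q :=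
  let m := cinv a x in
  let B := jacobian (cmap (chart_at m) \o cinv a) x in
  B *m gram g m *m B^T.

Lemma qform_gram_in a x h :
  qform (gram_in a x) h = qform (gram g (cinv a x)) (frame a x h).
Proof.
rewrite /qform /gram_in /frame /jacobian.
by rewrite -[in RHS](mul_rV_lin1 _ h) trmx_mul !mulmxA.
Qed.

(** The Gram matrices in the fixed chart at [m] vary continuously, so the coercivity constant at the
    base point survives on a small ball up to a factor. This translates the metric bounds of the
    hypotheses into coordinate bounds. *)
Lemma tangent_norm_frame_bounds m : exists k L r : R,
  [/\ 0 < k, 0 < L, 0 < r & forall x, ball (base_coord m) r x ->
    cimg (chart_at m) x /\ forall h,
    k * `|h| <= tangent_norm g (cinv (chart_at m) x) (frame (chart_at m) x h)
      <= L * `|h|].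
Proof.
set a := chart_at m; set x0 := base_coord m; pose G := gram_in a.
have cG : {for x0, continuous G}.
  by apply: (gram_smooth g (chart_at_atlas m) 0); exact: base_coord_img.
have [k0 k00 k0G] := posdef_coercive (gram_sym g m) (gram_posdef g m).
have Gx0 h : k0 * `|h| ^+ 2 <= qform (G x0) h.
  by rewrite (le_trans (k0G h))// qform_gram_in frame_base base_coordK.
have [L [d [L0 d0 LG]]] := qform_perturb k00 Gx0.
have Gnear : \forall x \near x0, `|G x - G x0| < d /\ cimg a x.
  near=> x; split; last first.
    near: x; apply: open_nbhs_nbhs; split; first exact: cimg_open.
    exact: base_coord_img.
  rewrite distrC; near: x.
  by move/cvgrPdist_lt : cG; exact.
have /nbhs_ballP[r /= r0 rG] := Gnear.
exists (Num.sqrt (k0 / 2)), (Num.sqrt L), r; split => //.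
- by rewrite sqrtr_gt0 divr_gt0.
- by rewrite sqrtr_gt0.
move=> x /rG[/LG Gx ax]; split; [exact: ax|move=> h].
have /andP[Gx1 Gx2] := Gx h.
have -> : tangent_norm g (cinv a x) (frame a x h) = Num.sqrt (qform (G x) h).
  by rewrite qform_gram_in.
have -> : `|h| = Num.sqrt (`|h| ^+ 2) by rewrite sqrtr_sqr normr_id.
rewrite -!sqrtrM ?divr_ge0 ?(ltW L0) ?(ltW k00)//.
by apply/andP; split; apply: ler_wsqrtr.
Unshelve. all: by end_near. Qed.

End TangentNorm.

Section OrbitLipschitz.
Variables (R : realType) (q : nat) (M : manifold R q) (g : riemannian M).
Variables (phi : R -> M -> M) (b K : R).
Hypothesis K_ge0 : 0 <= K.
Hypothesis phi_C1 : forall t, C1_map (phi t).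
Hypothesis phi_bound : forall t : R, 0 <= t ->
  (ereal_sup [set tmap_norm g (phi (- t)%R) m | m in [set: M]]
      <= (K * expR (b * t))%:E)%E.
Variable w : M -> R.
Hypothesis w_bounded : bounded_C1 g w.

(** [B] and [r] do not depend on [t]: the chart is only used at the starting point, and the far end
    of the orbit enters through the metric bounds on T phi^{-t} and Dw. This uniformity is what
    gives domination under the integral. *)
Lemma orbit_diff_bound m : exists B r : R, [/\ 0 <= B, 0 < r &
  forall t x, 0 <= t -> ball (base_coord m) r x ->
  [/\ cimg (chart_at m) x,
    differentiable (w \o phi (- t) \o cinv (chart_at m)) x &
    forall h, `|'d (w \o phi (- t) \o cinv (chart_at m)) x h| <=
      B * expR (b * t) * `|h|]].
Proof.
have [w1 _ /lty_real_ub[S S0 wS]] := w_bounded.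
have [k [L [r [_ L0 r0 bd]]]] := tangent_norm_frame_bounds g m.
exists (S * K * L), r; split => //; first by rewrite !mulr_ge0// ltW.
move=> t x t0 /bd[ax xbd].
have [dw dwE] := diff_C1_map (phi_C1 (- t)) w1 (chart_at_atlas m) ax.
split => // h; rewrite dwE.
set m' := cinv _ x; set v := frame _ _ _.
have wS' : (tdiff_norm g w (phi (- t) m') <= S%:E)%E.
  by apply: le_trans wS; apply: ereal_sup_ubound; exists (phi (- t) m').
have pT : (tmap_norm g (phi (- t)) m' <= (K * expR (b * t))%:E)%E.
  by apply: le_trans (phi_bound t0); apply: ereal_sup_ubound; exists m'.
apply: le_trans (tdiff_le _ wS') _.
apply: le_trans (ler_wpM2l S0 (tmap_le v pT)) _.
have /andP[_ vL] := xbd h.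
apply: le_trans (_ : S * (K * expR (b * t) * (L * `|h|)) <= _).
  by rewrite ler_wpM2l// ler_wpM2l// mulr_ge0// expR_ge0.
by rewrite le_eqVlt; apply/orP; left; apply/eqP; ring.
Qed.

End OrbitLipschitz.

(** * Short-time confinement of trajectories to a chart *)

Section MeanValue.
Variables (R : realType) (q : nat).

(** The norm on row vectors is the max norm, so the scalar mean value theorem can be applied to each
    coordinate without loss in the constant. *)
Lemma rV_mean_value (y y' : R -> 'rV[R]_q) (c : 'rV[R]_q) (C s : R) :
  0 <= C -> 0 <= s ->
  (forall u : R, 0 <= u <= s -> is_derive u (1 : R) y (y' u)) ->
  (forall u : R, 0 <= u <= s -> `|y' u - c| <= C) ->
  `|y s - y 0 - s *: c| <= C * s.
Proof.
move=> C0 s0 dy yC; apply: normr_mx_le; first by rewrite mulr_ge0.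
move=> i j; rewrite ord1 {i}.
have dyj u : u \in `[0, s] ->
    is_derive u (1 : R) (fun u => y u 0 j) (y' u 0 j).
  rewrite in_itv/= => /dy[dyu <-]; split; first exact: (derivable_mxP _ _ _).1.
  by rewrite derive_mx// mxE.
pose f u : R := y u 0 j; pose df u : R := y' u 0 j.
have dfo u : u \in `]0, s[ -> is_derive u (1 : R) f (df u).
  by move=> us; apply: dyj; exact: subset_itv_oo_cc us.
have cf : {within `[0, s], continuous f}.
  by apply: derivable_within_continuous => u /dyj[].
have [u us fE] := MVT_segment s0 dfo cf.
have yE : y s 0 j - y 0 0 j = y' u 0 j * s by rewrite -[s in RHS]subr0.
rewrite !mxE yE [s * _]mulrC -mulrBl normrM (ger0_norm s0) ler_wpM2r//.
move: us; rewrite in_itv/= => /yC; apply: le_trans.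
by have := normr_entry (y' u - c) 0 j; rewrite !mxE.
Qed.

End MeanValue.

Section Bootstrap.
Variables (R : realType) (q : nat) (M : manifold R q) (a : chart R q M).
Variables (F : 'rV[R]_q -> 'rV[R]_q) (x0 : 'rV[R]_q) (r L : R).
Hypothesis L_ge0 : 0 <= L.
Hypothesis ball_img : forall x, `|x - x0| < r -> cimg a x.
Hypothesis F_le : forall x, `|x - x0| < r -> `|F x| <= L * `|x - x0|.

(** The Hausdorff axiom enters here: the continuous image of a compact coordinate ball is compact,
    hence closed in [M]. *)
Lemma compact_chart_ball (s : R) : s < r ->
  closed (cinv a @` [set x | `|x - x0| <= s]).
Proof.
move=> sr; apply: compact_closed; first exact: manifold_hausdorff.
apply: continuous_compact.
  apply/continuous_in_subspaceT => x /[!inE] xs; apply: cinv_cont.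
  exact/ball_img/(le_lt_trans xs).
apply: bounded_closed_compact.
  exists (`|x0| + s); split; first exact: num_real.
  move=> y sy x /= xs; rewrite (le_trans _ (ltW sy))// -(subrK x0 x).
  by rewrite (le_trans (ler_normD _ _))// addrC lerD2l.
pose f (x : 'rV[R]_q) : R := `|x - x0|.
have cf : continuous f.
  by move=> x; exact: (cvg_norm (cvgB cvg_id (cvg_cst x0))).
exact: ((continuous_closedP f).1 cf _ (@closed_le R s)).
Qed.

Variable c : R -> M.
Hypothesis c_cont : continuous c.
Hypothesis c_ode : forall s : R, cdom a (c s) ->
  is_derive s (1 : R) (cmap a \o c) (F (cmap a (c s))).
Hypothesis c0_dom : cdom a (c 0).
Let rho := `|cmap a (c 0) - x0|.
Hypothesis rho_gt0 : 0 < rho.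
Hypothesis rho_lt : 2 * rho < r.

Let U (u : R) := cdom a (c u) /\ `|cmap a (c u) - x0| < 2 * rho.

(** Within distance [2 * rho] of [x0] the speed is at most [L * (2 * rho)]. *)
Lemma curve_displacement (s : R) : 0 <= s ->
  (forall u : R, 0 <= u <= s -> U u) ->
  `|cmap a (c s) - cmap a (c 0)| <= 2 * L * rho * s.
Proof.
move=> s0 sU; have := @rV_mean_value R q (cmap a \o c) (F \o cmap a \o c) 0
  (2 * L * rho) s.
rewrite /= scaler0 subr0; apply=> //.
- by rewrite !mulr_ge0// ltW.
- by move=> u /sU[cu _]; exact: c_ode.
- move=> u /sU[cu ur]; rewrite subr0 (le_trans (F_le _))//.
    exact: lt_trans ur _.
  by rewrite [2 * L]mulrC -mulrA ler_wpM2l// ltW.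
Qed.

(* The ball of radius [3/2 rho] has a compact, hence closed, preimage in the
   Hausdorff space [M], so a curve can leave the chart only through the shell
   between [3/2 rho] and [2 rho], which it has no time to reach. *)
Lemma curve_stays (t : R) : 0 <= t -> 4 * L * t <= 1 ->
  forall u : R, 0 <= u <= t -> U u.
Proof.
move=> t0 Lt; apply: contrapT => /existsNP[u1 /not_implyP[u1t nU1]].
pose B := cinv a @` [set x | `|x - x0| <= 3 / 2 * rho].
have rr : 3 / 2 * rho < r by apply: le_lt_trans rho_lt; move: rho_gt0; lra.
have cB : closed B by exact: compact_chart_ball.
have BU u : B (c u) -> U u.
  move=> [z /= zr zu]; have az : cimg a z by apply: ball_img; apply: le_lt_trans rr.
  rewrite /U -zu; split; first exact: cdom_cinv.
  by rewrite cinvK//; apply: le_lt_trans zr _; move: rho_gt0; lra.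
have Unear u : U u -> \forall v \near u, U v.
  move=> [cu ur]; have cn := chart_near (c_cont (x := u)) cu.
  near=> v; split; first by near: v; exact: cn.
  near: v; apply: cvgr_lt ur; apply: cvg_norm; apply: cvgB; last exact: cvg_cst.
  have [d _] := c_ode cu.
  by apply: differentiable_continuous; apply/derivable1_diffP.
(* As [4 * L * t <= 1], the displacement is at most [rho / 2], and the starting point is at distance
   [rho]. *)
have UB u : 0 <= u <= t -> (forall v : R, 0 <= v <= u -> U v) -> B (c u).
  move=> /andP[u0 ut] uU; have [cu _] : U u by apply: uU; rewrite u0 lexx.
  exists (cmap a (c u)); last by rewrite cmapK.
  have := curve_displacement u0 uU => /= h.
  rewrite -(subrK (cmap a (c 0)) (cmap a (c u))) -addrA.
  apply: le_trans (ler_normD _ _) _; rewrite -/rho.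
  have : 2 * L * rho * u <= 2 * L * rho * t.
    by rewrite ler_wpM2l// !mulr_ge0// ltW.
  by move: h Lt rho_gt0; nra.
pose S := [set u : R | 0 <= u <= t /\ ~ U u].
have iS : has_inf S.
  by split; [exists u1|exists 0 => u [/andP[]]].
pose s := inf S.
have s0 : 0 <= s by apply: lb_le_inf; [exists u1|move=> u [/andP[]]].
have slb : lbound S s by apply: ge_inf; have [] := iS.
have st : s <= t by apply: le_trans (slb u1 _) _ => //; case/andP: u1t.
have below u : 0 <= u -> u < s -> U u.
  move=> u0 us; apply: contrapT => nU.
  have : S u by split => //; rewrite u0 (le_trans (ltW us)).
  by move=> /slb; rewrite leNgt us.
have Bs : B (c s).
  (* At [s = 0] there are no earlier times to take a limit from, so the starting point is placed in
     [B] directly; otherwise closedness of [B] passes to the left limit. *)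
  move: s0; rewrite le_eqVlt => /orP[/eqP s00|s0].
    rewrite -s00; exists (cmap a (c 0)); last by rewrite cmapK.
    by rewrite /= -/rho; move: rho_gt0; lra.
  apply: (@closed_cvg _ _ (s^'-) _ c B cB) (c s) _.
    near=> u; have u0 : 0 < u by near: u; exact: nbhs_left_gt.
    have us : u < s by near: u; exact: nbhs_left_lt.
    apply: UB; first by rewrite ltW//= (le_trans (ltW us)).
    by move=> v /andP[v0 vu]; apply: below => //; exact: le_lt_trans us.
  exact/cvg_at_left_filter/c_cont.
have /Unear/nbhs_ballP[d /= d0 dU] := BU _ Bs.
have [e Se es] := inf_adherent d0 iS.
have [_] := Se; apply; apply: dU; rewrite /ball/= ltr_distlC.
have se := slb _ Se; rewrite (lt_le_trans _ se)//=.
by rewrite ltrBlDr ltrDl.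
Unshelve. all: by end_near. Qed.

End Bootstrap.

(** * Expansion of the flow differential in time *)

Lemma near0_norm_lt (R : realType) (V : normedModType R) (e : R) : 0 < e ->
  \forall h \near (0 : V), `|h| < e.
Proof.
move=> e0; apply/nbhs_ballP; exists e => //= h.
by rewrite -ball_normE/= sub0r normrN.
Qed.

(** Both sides scale by the same positive factor, so an estimate near 0 is a global one. *)
Lemma homogeneous_near_le (R : realType) (V W : normedModType R) (D : V -> W)
    (A : R) : (forall (s : R) h, D (s *: h) = s *: D h) ->
  (\forall h \near (0 : V), `|D h| <= A * `|h|) ->
  forall h, `|D h| <= A * `|h|.
Proof.
move=> DZ /nbhs_ballP[r /= r0 rD] h.
have [->|h0] := eqVneq h 0.
  by rewrite -(scale0r (0 : V)) DZ !scale0r !normr0 mulr0.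
have nh0 : 0 < `|h| by rewrite normr_gt0.
have [s s0 sh] : exists2 s : R, 0 < s & s * `|h| < r.
  exists (r / (2 * `|h|)); first by rewrite divr_gt0// mulr_gt0.
  rewrite invfM mulrA mulfVK ?gt_eqF//.
  by rewrite ltr_pdivrMr// ltr_pMr// ltr1n.
have := rD (s *: h).
rewrite -ball_normE/= sub0r normrN DZ !normrZ gtr0_norm// => /(_ sh).
by rewrite mulrCA ler_pM2l.
Qed.

Section Linearise.
Variables (R : realType) (q : nat) (M : manifold R q).
Variables (psi : R -> M -> M) (F : 'rV[R]_q -> 'rV[R]_q) (a : chart R q M).
Variable x0 : 'rV[R]_q.
Hypothesis x0a : cimg a x0.
Hypothesis psi0 : forall n, psi 0 n = n.
Hypothesis psi_cont : forall n, continuous (psi ^~ n).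
Hypothesis psi_ode : forall n s, cdom a (psi s n) ->
  is_derive s (1 : R) (cmap a \o psi ^~ n) (F (cmap a (psi s n))).
Variables (D : {linear 'rV[R]_q -> 'rV[R]_q}) (k : R).
Hypothesis k0 : 0 < k.
Hypothesis kD : forall h, `|D h| <= k * `|h|.
Hypothesis F_approx : forall e, 0 < e -> \forall h \near (0 : 'rV[R]_q),
  `|F (h + x0) - D h| <= e * `|h|.
Variable E : R -> {linear 'rV[R]_q -> 'rV[R]_q}.
Hypothesis E_approx : forall t e, 0 < e -> \forall h \near (0 : 'rV[R]_q),
  `|cmap a (psi t (cinv a (h + x0))) - x0 - E t h| <= e * `|h|.

(* Here [E t] is the differential at [x0] of the time-[t] map.  For small [h]
   two applications of the mean value inequality to the orbit of [h + x0] give the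
   estimate up to [o(h)], and the left-hand side is homogeneous in [h]. *)
Lemma flow_linear_taylor : exists T c : R, [/\ 0 < T, 0 <= c &
  forall t, 0 <= t <= T -> forall h,
  `|E t h - h - t *: D h| <= c * t ^+ 2 * `|h|].
Proof.
(* [k] bounds [D], and the 1 is the linearisation error of [F] taken with [e = 1]. *)
pose L := k + 1; have L0 : 0 < L by rewrite addr_gt0.
have [r r0 rF] : exists2 r : R, 0 < r & forall x, `|x - x0| < r ->
    cimg a x /\ `|F x| <= L * `|x - x0|.
  have /nbhs_ballP[r1 /= r10 r1a] : nbhs x0 (cimg a).
    by apply: open_nbhs_nbhs; split => //; exact: cimg_open.
  have /nbhs_ballP[r2 /= r20 r2F] := F_approx ltr01.
  exists (Num.min r1 r2); first by rewrite lt_min r10.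
  move=> x; rewrite lt_min => /andP[xr1 xr2]; split.
    by apply: r1a; rewrite -ball_normE/= distrC.
  have := r2F (x - x0); rewrite -ball_normE/= sub0r normrN subrK.
  move=> /(_ xr2); rewrite mul1r => h.
  rewrite -(subrK (D (x - x0)) (F x)) (le_trans (ler_normD _ _))//.
  by rewrite /L mulrDl mul1r addrC lerD.
(* The longest time that [curve_stays] allows. *)
pose T := (4 * L)^-1; have T0 : 0 < T by rewrite invr_gt0 mulr_gt0.
exists T, (2 * k * L); split => //; first by rewrite !mulr_ge0// ltW.
move=> t /andP[t0 tT] h.
pose La v := E t v - v - t *: D v.
have LaZ (s : R) v : La (s *: v) = s *: La v.
  rewrite /La; have -> : E t (s *: v) = s *: E t v by rewrite linearZ.
  have -> : D (s *: v) = s *: D v by rewrite linearZ.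
  by rewrite !scalerBr !scalerA [t * s]mulrC.
(* In the error [e * (2 * t + 1)], one [e] comes from replacing the flow by [E t], and [2 * e * t]
   from linearising [F] along a curve within [2 * |h|] of [x0]. Homogeneity frees [h] from its
   dependence on [e], which then tends to 0. *)
rewrite -/(La h); move: h; suff key e : 0 < e -> \forall h \near (0 : 'rV[R]_q),
    `|La h| <= (2 * k * L * t ^+ 2 + e * (2 * t + 1)) * `|h|.
  move=> h; apply/ler_addgt0Pr => e e0.
  have t1 : 0 < (2 * t + 1) * (`|h| + 1).
    by rewrite mulr_gt0// ltr_wpDl// mulr_ge0.
  have := homogeneous_near_le LaZ (key _ (divr_gt0 e0 t1)) h.
  move=> /le_trans; apply; rewrite mulrDl lerD2l.
  rewrite -mulrA mulrAC ler_pdivrMr// ler_pM2l// ler_wpM2l ?lerDl//.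
  by rewrite addr_ge0// mulr_ge0.
move=> e0.
have /nbhs_ballP[r2 /= r20 r2F] := F_approx e0.
have Ene := E_approx t e0.
have m0 : 0 < Num.min (r / 2) (r2 / 2) by rewrite lt_min !divr_gt0.
have hn := @near0_norm_lt R 'rV[R]_q _ m0.
near=> h.
have hmin : `|h| < Num.min (r / 2) (r2 / 2).
  by near: h; exact: hn.
have Eh : `|cmap a (psi t (cinv a (h + x0))) - x0 - E t h| <= e * `|h|.
  by near: h; exact: Ene.
have [->|h0] := eqVneq h 0.
  by have := LaZ 0 0; rewrite !scale0r => ->; rewrite !normr0 mulr0.
set rho := `|h|; have rho0 : 0 < rho by rewrite normr_gt0.
have [hr hr2] : 2 * rho < r /\ 2 * rho < r2.
  by move: hmin; rewrite -/rho lt_min => /andP[? ?]; rewrite mulrC -!ltr_pdivlMr.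
have hx0a : cimg a (h + x0).
  by have [] := rF (h + x0); rewrite ?addrK// -/rho; move: rho0 hr; lra.
pose c := psi ^~ (cinv a (h + x0)).
have c0 : cmap a (c 0) = h + x0 by rewrite /c psi0 cinvK.
have c0a : cdom a (c 0) by rewrite /c psi0; exact: cdom_cinv.
have rho' : `|cmap a (c 0) - x0| = rho by rewrite c0 addrK.
have tL : 4 * L * t <= 1 by rewrite mulrC -ler_pdivlMr ?mulr_gt0// div1r.
have stay u : 0 <= u <= t -> cdom a (c u) /\ `|cmap a (c u) - x0| < 2 * rho.
  rewrite -rho'; apply: (@curve_stays _ _ _ _ F x0 r L) => //.
  - exact: ltW.
  - by move=> x /rF[].
  - by move=> x /rF[].
  - exact: psi_cont.
  - by rewrite rho'.
  - by rewrite rho'.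
have disp u : 0 <= u <= t -> `|cmap a (c u) - (h + x0)| <= 2 * L * rho * u.
  move=> /andP[u0 ut]; rewrite -c0 -rho'.
  apply: (@curve_displacement _ _ _ _ F x0 r L) => //.
  - exact: ltW.
  - by move=> x /rF[].
  - by rewrite rho'.
  - by rewrite rho'.
  - by move=> v /andP[v0 vu]; rewrite rho'; apply: stay; rewrite v0 (le_trans vu).
have := @rV_mean_value R q (cmap a \o c) (F \o cmap a \o c) (D h)
  ((2 * e + 2 * k * L * t) * rho) t.
have C0 : 0 <= (2 * e + 2 * k * L * t) * rho.
  have [k0' L0' e0'] := And3 (ltW k0) (ltW L0) (ltW e0).
  by rewrite mulr_ge0 ?(ltW rho0)// addr_ge0// !mulr_ge0.
move=> /(_ C0 t0) mv.
have {}mv : `|cmap a (c t) - (h + x0) - t *: D h| <=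
    (2 * e + 2 * k * L * t) * rho * t.
  rewrite -c0; apply: mv => u ut; have [cu cur] := stay u ut.
    exact: psi_ode.
  have := r2F (cmap a (c u) - x0); rewrite -ball_normE/= sub0r normrN subrK.
  move=> /(_ (lt_trans cur hr2)) FD.
  (* Linearisation error at the current point, plus [D] applied to the displacement from the start;
     the latter is O(t) and yields the t^2 term. *)
  have -> : F (cmap a (c u)) - D h = (F (cmap a (c u)) - D (cmap a (c u) - x0)) +
      D (cmap a (c u) - (h + x0)).
    have -> : cmap a (c u) - (h + x0) = (cmap a (c u) - x0) - h.
      by rewrite opprD addrA addrAC.
    by rewrite (linearB D (cmap a (c u) - x0) h) addrA subrK.
  apply: le_trans (ler_normD _ _) _.
  have := kD (cmap a (c u) - (h + x0)).
  have := ler_wpM2l (ltW k0) (disp u ut).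
  have : 2 * k * L * rho * u <= 2 * k * L * rho * t.
    by case/andP: ut => _ ut; rewrite ler_wpM2l// !mulr_ge0// ltW.
  have := ler_wpM2l (ltW e0) (ltW cur).
  by move: FD; lra.
have -> : La h = - (cmap a (c t) - x0 - E t h) +
    (cmap a (c t) - (h + x0) - t *: D h).
  rewrite /La !opprB opprD; apply/rowP => i; rewrite !mxE; ring.
apply: le_trans (ler_normD _ _) _; rewrite normrN.
apply: le_trans (lerD Eh mv) _; rewrite -/rho.
by rewrite le_eqVlt; apply/orP; left; apply/eqP; ring.
Unshelve. all: by end_near.
Qed.

End Linearise.

(** The reversed flow [phi (- t)] solves the equation of the field [- F], so the estimate for
    nonnegative times is applied to both. *)
Lemma flow_linear_taylor_two_sided (R : realType) (q : nat) (M : manifold R q)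
    (phi : R -> M -> M) (F : 'rV[R]_q -> 'rV[R]_q) (a : chart R q M)
    (x0 : 'rV[R]_q) (D : {linear 'rV[R]_q -> 'rV[R]_q}) (k : R)
    (E : R -> {linear 'rV[R]_q -> 'rV[R]_q}) : cimg a x0 ->
  (forall n, phi 0 n = n) -> (forall n, continuous (phi ^~ n)) ->
  (forall n s, cdom a (phi s n) ->
    is_derive s (1 : R) (cmap a \o phi ^~ n) (F (cmap a (phi s n)))) ->
  0 < k -> (forall h, `|D h| <= k * `|h|) ->
  (forall e, 0 < e -> \forall h \near (0 : 'rV[R]_q),
    `|F (h + x0) - D h| <= e * `|h|) ->
  (forall t e, 0 < e -> \forall h \near (0 : 'rV[R]_q),
    `|cmap a (phi t (cinv a (h + x0))) - x0 - E t h| <= e * `|h|) ->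
  exists T c : R, [/\ 0 < T, 0 <= c & forall t, `|t| <= T -> forall h,
    `|E t h - h - t *: D h| <= c * t ^+ 2 * `|h|].
Proof.
move=> x0a phi0 phi_cont phi_ode k0 kD F_approx E_approx.
have [T1 [c1 [T10 c10 H1]]] := flow_linear_taylor x0a phi0 phi_cont phi_ode
  k0 kD F_approx E_approx.
pose psi t n := phi (- t) n; pose F' x := - F x.
have psi0 n : psi 0 n = n by rewrite /psi oppr0 phi0.
have psi_cont n : continuous (psi ^~ n).
  move=> t; apply: (@continuous_comp _ _ _ (fun t : R => - t) (phi ^~ n)).
    exact: oppr_continuous.
  exact: phi_cont.
have psi_ode n s : cdom a (psi s n) ->
    is_derive s (1 : R) (cmap a \o psi ^~ n) (F' (cmap a (psi s n))).
  move=> an; have [/derivable1_diffP d dE] := phi_ode _ _ an.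
  have := @is_derive_comp_diff R _ _ -%R (cmap a \o phi ^~ n) s (-1)
     (is_deriveNid s 1) d.
  by rewrite /F' -dE deriveE// linearN.
pose D' : {linear 'rV[R]_q -> 'rV[R]_q} := (-%R \o D).
have D'E h : D' h = - D h by [].
have kD' h : `|D' h| <= k * `|h| by rewrite D'E normrN.
have F'_approx e : 0 < e -> \forall h \near (0 : 'rV[R]_q),
    `|F' (h + x0) - D' h| <= e * `|h|.
  move=> e0; have := F_approx e e0; apply: filterS => h.
  have -> : F' (h + x0) - D' h = - (F (h + x0) - D h).
    by rewrite D'E /F' opprB opprK addrC.
  by rewrite normrN.
have [T2 [c2 [T20 c20 H2]]] := flow_linear_taylor x0a psi0 psi_cont
  psi_ode k0 kD' F'_approx (fun t => E_approx (- t)).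
exists (Num.min T1 T2), (c1 + c2); split.
- by rewrite lt_min T10.
- exact: addr_ge0.
move=> t tT h; have [t0|t0] := leP 0 t.
  apply: le_trans (H1 t _ h) _.
    by rewrite t0/=; move: tT; rewrite ger0_norm// le_min => /andP[].
  by rewrite ler_wpM2r// ler_wpM2r ?sqr_ge0// lerDl.
have := H2 (- t); rewrite opprK => /(_ _ h); rewrite D'E scalerN scaleNr opprK.
rewrite sqrrN => H2'; apply: le_trans (H2' _) _.
  rewrite oppr_ge0 (ltW t0)/=; move: tT; rewrite ltr0_norm// le_min.
  by move=> /andP[].
by rewrite ler_wpM2r// ler_wpM2r ?sqr_ge0// lerDr.
Qed.

(** Since E(t + h) v - E(t) v = E(t) (E(h) v - v), the derivative at any time reduces to the one at
    time 0, where the quadratic estimate gives it. *)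
Lemma semigroup_derive (R : realType) (q : nat)
    (E : R -> {linear 'rV[R]_q -> 'rV[R]_q})
    (D : {linear 'rV[R]_q -> 'rV[R]_q}) (T c : R) : 0 < T -> 0 <= c ->
  (forall s t h, E (s + t) h = E s (E t h)) -> (forall t, continuous (E t)) ->
  (forall t, `|t| <= T -> forall h,
    `|E t h - h - t *: D h| <= c * t ^+ 2 * `|h|) ->
  forall v t, is_derive t (1 : R) (E ^~ v) (E t (D v)).
Proof.
move=> T0 c0 ED cE H v t.
have [k k0 kE] : exists2 k : R, 0 < k & forall h, `|E t h| <= k * `|h|.
  exact: (linear_lipschitz (cE t)).
have EB x y : E t (x - y) = E t x - E t y by exact: raddfB.
have EZ s x : E t (s *: x) = s *: E t x by exact: linearZ.
have kc0 : 0 < k * c * `|v| + 1 by rewrite ltr_wpDl// !mulr_ge0// ltW.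
have cv : h^-1 *: (E (h *: 1 + t) v - E t v) @[h --> 0^'] --> E t (D v).
  apply/cvgrPdist_le => /= e e0.
  have d0 : 0 < e / (k * c * `|v| + 1) by rewrite divr_gt0.
  near=> h; have h0 : h != 0 by near: h; exact: nbhs_dnbhs_neq.
  have hT : `|h| <= T.
    by apply: ltW; near: h; exact: dnbhs0_lt.
  have hd : `|h| <= e / (k * c * `|v| + 1).
    by apply: ltW; near: h; exact: dnbhs0_lt.
  have -> : E (h *: 1 + t) v = E t (E h v).
    by rewrite [_ *: _]mulr1 addrC ED.
  have -> : E t (D v) - h^-1 *: (E t (E h v) - E t v) =
      E t (D v - h^-1 *: (E h v - v)).
    by rewrite EB EZ EB.
  apply: le_trans (kE _) _; rewrite distrC.
  have -> : h^-1 *: (E h v - v) - D v = h^-1 *: (E h v - v - h *: D v).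
    by rewrite [RHS]scalerBr scalerA mulVf// scale1r.
  rewrite normrZ normfV.
  have h0' : 0 < `|h| by rewrite normr_gt0.
  have hh : `|h|^-1 * (c * h ^+ 2 * `|v|) = c * `|v| * `|h|.
    by rewrite -(real_normK (num_real h)); field; rewrite gt_eqF.
  have := H h hT v.
  rewrite -(@ler_pM2l _ `|h|^-1) ?invr_gt0// hh.
  move=> /(ler_wpM2l (ltW k0))/le_trans; apply.
  apply: le_trans (_ : (k * c * `|v| + 1) * `|h| <= _).
    by rewrite !mulrA ler_wpM2r// lerDl.
  by rewrite mulrC -ler_pdivlMr.
split; first by apply/cvg_ex; exists (E t (D v)).
exact: cvg_lim cv.
Unshelve. all: by end_near. Qed.

Lemma is_derive_linear (R : realType) (V W : normedModType R)
    (L : {linear V -> W}) (c : R -> V) (s : R) (v : V) : continuous L ->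
  is_derive s (1 : R) c v -> is_derive s (1 : R) (L \o c) (L v).
Proof.
move=> cL dc; have dL := @linear_differentiable _ _ _ L (c s) cL.
have := is_derive_comp_diff dc dL.
by rewrite (congr1 (@^~ v) (diff_lin (c s) cL)).
Qed.

Lemma is_derive_opp_arg (R : realType) (V : normedModType R)
    (c : R -> V) (s : R) (v : V) :
  is_derive (- s) (1 : R) c v -> is_derive s (1 : R) (fun t => c (- t)) (- v).
Proof.
move=> [/derivable1_diffP d dE].
have := @is_derive_comp_diff R _ _ -%R c s (-1) (is_deriveNid s 1) d.
by rewrite -dE deriveE// linearN.
Qed.

Lemma is_derive_linear_opp_arg (R : realType) (V W : normedModType R)
    (L : {linear V -> W}) (c : R -> V) (s : R) (v : V) : continuous L ->
  is_derive (- s) (1 : R) c v ->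
  is_derive s (1 : R) (fun t => L (c (- t))) (- L v).
Proof.
move=> cL dc; have := is_derive_linear cL (is_derive_opp_arg dc).
by rewrite linearN.
Qed.

(** * The flow at a fixed point *)

Section FixedPoint.
Variables (R : realType) (q : nat) (M : manifold R q).
Variables (V : M -> 'rV[R]_q) (phi : R -> M -> M).
Hypothesis V_smooth : smooth_vfield V.
Hypothesis phi_flow : is_flow V phi.
Hypothesis phi_C1 : forall t, C1_map (phi t).

(** [is_flow] speaks of the preferred chart at the current point, which changes along the orbit. The
    mean value estimates need the equation in one fixed chart [b]. *)
Lemma flow_in_chart b (n : M) (s : R) : atlas b -> cdom b (phi s n) ->
  is_derive s (1 : R) (cmap b \o phi ^~ n) (vfield_coord V b (cmap b (phi s n))).
Proof.
have [_ _ phi_cont phi_ode] := phi_flow.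
move=> ab bn; set k := phi s n; pose c := chart_at k.
have [/derivable1_diffP dc cE] := phi_ode n s.
have ck : cdom c k := chart_at_dom k.
have dbc : differentiable (cmap b \o cinv c) (cmap c k).
  apply: transition_differentiable => //; first exact: chart_at_atlas.
    exact: base_coord_img.
  by rewrite cmapK.
have [db dbE] := chart_chain (phi_cont n s) ck dc dbc.
split; first exact/derivable1_diffP.
rewrite deriveE// dbE /vfield_coord cmapK// -cE.
by rewrite deriveE// /jacobian -/c mul_rV_lin1.
Qed.

Variable m : M.
Hypothesis m_fix : forall t, phi t m = m.
Let a := chart_at m.
Let x0 := base_coord m.
Let F := vfield_coord V a.

(** T_m phi^t with the target chart written as [a] instead of the preferred chart at [phi t m], so
    that differentials at different times compose directly. *)
Definition flow_diff t : {linear 'rV[R]_q -> 'rV[R]_q} :=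
  'd (cmap a \o phi t \o cinv a) x0.

Lemma cmap_fix : cmap a m = x0. Proof. by []. Qed.

Lemma vfield_fixed : F x0 = 0.
Proof.
have am : cdom a (phi 0 m) by rewrite m_fix; exact: chart_at_dom.
have [_] := flow_in_chart (chart_at_atlas m) am.
rewrite m_fix -/a cmap_fix -/F => <-.
rewrite (_ : _ \o _ = cst x0) ?derive_cst//.
by apply/funext => t /=; rewrite m_fix.
Qed.

Lemma vfield_diff : differentiable F x0.
Proof.
have [+ _] := V_smooth (chart_at_atlas m) 1; apply; exact: base_coord_img.
Qed.

Lemma linearisationE v : 'd F x0 v = v *m linearisation V m.
Proof. by rewrite /linearisation /jacobian mul_rV_lin1. Qed.

Lemma flow_chart_differentiable t :
  differentiable (cmap a \o phi t \o cinv a) x0.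
Proof.
have [_ /(_ _ _ (chart_at_atlas m) (chart_at_atlas m))[+ _]] := phi_C1 t.
apply; exists m => //; split; first exact: chart_at_dom.
by rewrite /= m_fix; exact: chart_at_dom.
Qed.

Lemma flow_cinv_cont t : {for x0, continuous (phi t \o cinv a)}.
Proof.
apply: continuous_comp; first by apply: cinv_cont; exact: base_coord_img.
by have [+ _] := phi_C1 t; apply.
Qed.

Lemma flow_cinv_base t : (phi t \o cinv a) x0 = m.
Proof. by rewrite /= /a /x0 base_coordK m_fix. Qed.

Lemma diff_comp_flow (W : normedModType R) (f : M -> W) t :
  differentiable (f \o cinv a) x0 ->
  differentiable (f \o phi t \o cinv a) x0 /\
  forall h, 'd (f \o phi t \o cinv a) x0 h = 'd (f \o cinv a) x0 (flow_diff t h).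
Proof.
move=> df; have uE : (phi t \o cinv a) x0 = m := flow_cinv_base t.
have mE : cmap a ((phi t \o cinv a) x0) = x0 by rewrite uE.
have := @chart_chain R q M 'rV[R]_q W (phi t \o cinv a) f x0 a.
move=> /(_ (@flow_cinv_cont t)); rewrite mE uE.
apply; [exact: chart_at_dom|exact: flow_chart_differentiable|exact: df].
Qed.

Lemma flow_diffD s t h : flow_diff (s + t) h = flow_diff s (flow_diff t h).
Proof.
have [_ + _ _] := phi_flow; move=> phiD.
have [_ H] := diff_comp_flow t (flow_chart_differentiable s).
have E : cmap a \o phi (s + t) \o cinv a = (cmap a \o phi s) \o phi t \o cinv a.
  by apply/funext => x /=; rewrite phiD.
exact: (etrans (congr1 (fun f : 'rV[R]_q -> 'rV[R]_q => 'd f x0 h) E) (H h)).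
Qed.

Lemma flow_diff_taylor : exists T c : R, [/\ 0 < T, 0 <= c &
  forall t, `|t| <= T -> forall h,
  `|flow_diff t h - h - t *: 'd F x0 h| <= c * t ^+ 2 * `|h|].
Proof.
have [phi0 _ phi_cont _] := phi_flow.
have x0a : cimg a x0 := base_coord_img m.
have [k k0 kD] : exists2 k : R, 0 < k & forall h, `|'d F x0 h| <= k * `|h|.
  exact: (linear_lipschitz (diff_continuous vfield_diff)).
have F_approx e : 0 < e -> \forall h \near (0 : 'rV[R]_q),
    `|F (h + x0) - 'd F x0 h| <= e * `|h|.
  move=> e0; have := differentiable_approx vfield_diff e0.
  by apply: filterS => h; rewrite vfield_fixed subr0.
have E_approx t e : 0 < e -> \forall h \near (0 : 'rV[R]_q),
    `|cmap a (phi t (cinv a (h + x0))) - x0 - flow_diff t h| <= e * `|h|.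
  move=> e0; have := differentiable_approx (flow_chart_differentiable t) e0.
  by apply: filterS => h /=; rewrite /a /x0 base_coordK m_fix.
exact: (flow_linear_taylor_two_sided x0a phi0 phi_cont
  (fun n s => @flow_in_chart a n s (chart_at_atlas m)) k0 kD F_approx E_approx).
Qed.

(** Stands in for T_m phi^t = e^{Jt}: integration by parts only asks for this differential
    equation. *)
Lemma flow_diff_derive v t :
  is_derive t (1 : R) (flow_diff ^~ v) (flow_diff t ('d F x0 v)).
Proof.
have [T [c [T0 c0 H]]] := flow_diff_taylor.
apply: (semigroup_derive T0 c0 flow_diffD _ H).
by move=> s; exact: (diff_continuous (flow_chart_differentiable s)).
Qed.

Lemma orbit_diffE (w : M -> R) t : C1_fun w ->
  differentiable (w \o phi t \o cinv a) x0 /\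
  forall h, 'd (w \o phi t \o cinv a) x0 h = tdiff w m (flow_diff t h).
Proof.
move=> w1; apply: diff_comp_flow.
by have [+ _] := w1 _ (chart_at_atlas m); apply; exact: base_coord_img.
Qed.

Lemma orbit_diff_derive (w : M -> R) v t : C1_fun w ->
  is_derive t (1 : R) (fun s => tdiff w m (flow_diff (- s) v))
    (- tdiff w m (flow_diff (- t) (v *m linearisation V m))).
Proof.
move=> w1; have cw : continuous (tdiff w m).
  apply: diff_continuous; have [+ _] := w1 _ (chart_at_atlas m); apply.
  exact: base_coord_img.
have dv : is_derive (- t) (1 : R) (flow_diff ^~ v)
    (flow_diff (- t) (v *m linearisation V m)).
  exact: (eq_ind _ (fun z => is_derive (- t) (1 : R) (flow_diff ^~ v)
    (flow_diff (- t) z)) (flow_diff_derive v (- t)) _ (linearisationE v)).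
exact: (is_derive_linear_opp_arg (L := 'd (w \o cinv a) x0) cw dv).
Qed.

End FixedPoint.

(** * Differentiating the transform at a fixed point *)

Section RowPairing.
Variables (R : realType) (q : nat) (l : 'cV[R]_q).

(** Packaged as a linear map so that [differentiable_littleo] accepts it as a candidate
    differential. *)
Definition row_pairing (h : 'rV[R]_q) : R := (h *m l) 0 0.

Lemma row_pairing_is_linear : linear row_pairing.
Proof. by move=> c u v; rewrite /row_pairing mulmxDl -scalemxAl !mxE. Qed.

HB.instance Definition _ := GRing.isLinear.Build R 'rV[R]_q R _ row_pairing
  row_pairing_is_linear.

Lemma row_pairing_continuous : continuous row_pairing.
Proof.
move=> h; rewrite /row_pairing /continuous_at.
rewrite (_ : (fun h0 => _) = (fun h0 : 'rV[R]_q => \sum_i h0 0 i * l i 0)); last first.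
  by apply/funext => h'; rewrite mxE.
have FF : Filter (nbhs h) by exact: nbhs_filter.
rewrite mxE; apply: cvg_big => [|i _]; first exact: add_continuous.
by apply: cvgMl; exact: coord_continuous.
Qed.

End RowPairing.

(** Turns a neighbourhood statement into one about sequences, to which dominated convergence
    applies. One good index per sequence suffices, because a counterexample sequence would have
    none. *)
Lemma near0_seqP (R : realType) (V : normedModType R) (P : V -> Prop) :
  (forall h : nat -> V, (forall r, 0 < r -> \forall n \near \oo, `|h n| < r) ->
     exists n, P (h n)) ->
  \forall h \near (0 : V), P h.
Proof.
move=> hP; apply: contrapT => nP.
have ex n : exists h : V, `|h| < n.+1%:R^-1 /\ ~ P h.
  apply: contrapT => /forallNP H; apply: nP; apply/nbhs_ballP.
  exists n.+1%:R^-1 => //= h; rewrite -ball_normE/= sub0r normrN => hn.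
  by apply: contrapT => nPh; exact: (H h).
have [h hE] := choice ex.
have [|n Pn] := hP h; last by have [_] := hE n.
move=> r r0; near=> n; apply: lt_trans (proj1 (hE n)) _.
by near: n; exact: (near_infty_natSinv_lt (PosNum r0)).
Unshelve. all: by end_near. Qed.

Lemma C1_fun_continuous (R : realType) (q : nat) (M : manifold R q)
  (w : M -> R) : C1_fun w -> continuous w.
Proof.
move=> w1 n; pose b := chart_at n.
have dw : {for cmap b n, continuous (w \o cinv b)}.
  apply: differentiable_continuous.
  by have [+ _] := w1 _ (chart_at_atlas n); apply; exact: base_coord_img.
have cb : {for n, continuous (cmap b)}.
  by apply: cmap_continuous; exact: chart_at_dom.
have : {for n, continuous ((w \o cinv b) \o cmap b)}.
  exact: continuous_comp cb dw.
rewrite /prop_for /continuous_at /= cmapK; last exact: chart_at_dom.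
apply: cvg_trans; apply: near_eq_cvg.
have : \forall y \near n, cdom b y.
  apply: open_nbhs_nbhs; split; first exact: cdom_open.
  exact: chart_at_dom.
by apply: filterS => y /cmapK /= ->.
Qed.

Lemma Rintegral_cst0 (R : realType) (D : set R) :
  \int[lebesgue_measure]_(t in D) (0 : R) = 0.
Proof. by rewrite /Rintegral integral0. Qed.

Section LaplaceOrbit.
Variables (R : realType) (q : nat) (M : manifold R q) (g : riemannian M).
Variables (V : M -> 'rV[R]_q) (phi : R -> M -> M).
Hypothesis V_smooth : smooth_vfield V.
Hypothesis phi_flow : is_flow V phi.
Hypothesis phi_C1 : forall t, C1_map (phi t).
Variables (b K : R).
Hypothesis K_ge0 : 0 <= K.
Hypothesis phi_bound : forall t : R, 0 <= t ->
  (ereal_sup [set tmap_norm g (phi (- t)%R) m | m in [set: M]]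
      <= (K * expR (b * t))%:E)%E.
Variable w : M -> R.
Hypothesis w_bounded : bounded_C1 g w.
Variable d : R.
Hypothesis d_gt0 : 0 < d.
Hypothesis bd : b < d.
Notation mu := (@lebesgue_measure R).

Lemma orbit_continuous n : continuous (fun t => w (phi (- t) n)).
Proof.
have [_ _ phi_cont _] := phi_flow; have [w1 _ _] := w_bounded.
move=> t; apply: (@continuous_comp _ _ _ (fun t => phi (- t) n) w).
  apply: (@continuous_comp _ _ _ (fun t : R => - t) (phi ^~ n)).
    exact: oppr_continuous.
  exact: phi_cont.
exact: C1_fun_continuous.
Qed.

Lemma integrable_orbit n : mu.-integrable `[0, +oo[
  (EFin \o (fun t => expR (- d * t) * w (phi (- t) n))).
Proof.
have [_ /lty_real_ub[S S0 wS] _] := w_bounded.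
apply: (@integrable_laplace _ d 0 S) => //.
  by apply: continuous_measurable_fun; exact: orbit_continuous.
move=> t _; rewrite mul0r expR0 mulr1 -lee_fin (le_trans _ wS)//.
by apply: ereal_sup_ubound; exists (phi (- t) n).
Qed.

Variable m : M.
Hypothesis m_fix : forall t, phi t m = m.
Let a := chart_at m.
Let x0 := base_coord m.
Let J := linearisation V m.
Let y h t : R := tdiff w m (flow_diff phi m (- t) h).

Lemma flow_laplace_fixed : d * flow_laplace phi w d m = w m.
Proof.
rewrite /flow_laplace; under eq_Rintegral do rewrite m_fix.
(* With [y] constant and [z = 0], integration by parts evaluates the integral of e^{-dt}. *)
have -> := @laplace_derive R d 0 `|w m| (cst (w m)) (cst 0) d_gt0.
- rewrite (_ : (fun t => _) = cst 0); last by apply/funext => t; rewrite mulr0.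
  by rewrite /Rintegral integral0 addr0.
- exact: cst_continuous.
- by move=> t _; rewrite mul0r expR0 mulr1.
- by move=> t _; rewrite normr0 mulr_ge0// expR_ge0.
Qed.

Let w1 : C1_fun w. Proof. by have [] := w_bounded. Qed.

Lemma orbit_slope_derive h t : is_derive t (1 : R) (y h) (- y (h *m J) t).
Proof. exact: orbit_diff_derive. Qed.

Lemma orbit_slope_continuous h : continuous (y h).
Proof.
move=> t; have [dy _] := orbit_slope_derive h t.
by apply: differentiable_continuous; apply/derivable1_diffP.
Qed.

Lemma orbit_slope0 h : y h 0 = tdiff w m h.
Proof.
have [phi0 _ _ _] := phi_flow.
have [_ H] := orbit_diffE phi_C1 m_fix 0 w1.
rewrite /y oppr0; rewrite -(H h).
have E : w \o phi 0 \o cinv a = w \o cinv a.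
  by apply/funext => x /=; rewrite phi0.
exact: (congr1 (fun f : 'rV[R]_q -> R => 'd f x0 h) E).
Qed.

Lemma orbit_slope_sum h t : y h t = \sum_i h 0 i * y (delta_mx 0 i) t.
Proof.
rewrite /y {1}[h]row_sum_delta linear_sum /tdiff linear_sum.
by apply: eq_bigr => i _; rewrite linearZ linearZ.
Qed.

(* Differentiating under the integral gives [l h = int e^{-dt} y h t dt], with
   domination from [orbit_diff_bound] because [b < d].  Since
   [(y h)' = - y (h *m J)], integration by parts gives the last identity. *)
Lemma laplace_orbit_diff : exists l : 'cV[R]_q,
  [/\ differentiable (flow_laplace phi w d \o cinv a) x0,
      forall h, 'd (flow_laplace phi w d \o cinv a) x0 h = row_pairing l h &
      forall h, d * row_pairing l h + row_pairing l (h *m J) = tdiff w m h].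
Proof.
have [B [r [B0 r0 ub]]] := orbit_diff_bound K_ge0 phi_C1 phi_bound w_bounded m.
pose u t x := (w \o phi (- t) \o cinv a) x.
have yE t h : 'd (u t) x0 h = y h t.
  by have [_ H] := orbit_diffE phi_C1 m_fix (- t) w1; exact: H.
have yB h t : 0 <= t -> `|y h t| <= B * `|h| * expR (b * t).
  move=> t0; have [_ _] := ub t x0 t0 (ballxx x0 r0).
  by move=> /(_ h); rewrite [X in `|X|](yE t h) mulrAC.
have uL t h : 0 <= t -> `|h| < r ->
    `|u t (h + x0) - u t x0| <= B * expR (b * t) * `|h|.
  move=> t0 hr; have := @diff_ball_lipschitz R _ (u t) x0 r (B * expR (b * t)).
  move=> /(_ _ (h + x0)); rewrite addrK; apply.
    by move=> x xr; have [_ ? ?] := ub t x t0 xr.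
  by rewrite -ball_normE/= opprD addrCA subrr addr0 normrN.
have iy h : mu.-integrable `[0, +oo[ (EFin \o (fun t => expR (- d * t) * y h t)).
  apply: (integrable_laplace bd _ (yB h)).
  by apply: continuous_measurable_fun; exact: orbit_slope_continuous.
pose ell h := \int[mu]_(t in `[0, +oo[) (expR (- d * t) * y h t).
pose l : 'cV[R]_q := \col_i ell (delta_mx 0 i).
have ellE h : ell h = row_pairing l h.
  rewrite /row_pairing mxE /ell.
  rewrite (_ : (fun t => _) =
      fun t => \sum_i h 0 i * (expR (- d * t) * y (delta_mx 0 i) t)); last first.
    apply/funext => t; rewrite orbit_slope_sum mulr_sumr; apply: eq_bigr => i _.
    by rewrite mulrCA.
  rewrite Rintegral_sum//; last first.
    by move=> i; exact: (integrableZl _ (h 0 i) (iy _)).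
  by apply: eq_bigr => i _; rewrite RintegralZl// !mxE.
exists l.
have sylv h : d * row_pairing l h + row_pairing l (h *m J) = tdiff w m h.
  rewrite -!ellE /ell.
  have cz : continuous (fun t => - y (h *m J) t).
    by move=> t; apply: cvgN; exact: orbit_slope_continuous.
  (* [laplace_derive] wants one constant for the function and its derivative, hence the sum. *)
  have b1 t : 0 <= t -> `|y h t| <= (B * `|h| + B * `|h *m J|) * expR (b * t).
    move=> t0; apply: le_trans (yB _ _ t0) _.
    by rewrite mulrDl lerDl mulr_ge0 ?mulr_ge0 ?expR_ge0.
  have b2 t : 0 <= t ->
      `|- y (h *m J) t| <= (B * `|h| + B * `|h *m J|) * expR (b * t).
    move=> t0; rewrite normrN; apply: le_trans (yB _ _ t0) _.
    by rewrite mulrDl lerDr mulr_ge0 ?mulr_ge0 ?expR_ge0.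
  rewrite (laplace_derive bd (orbit_slope_derive h) cz b1 b2) orbit_slope0 -addrA.
  rewrite (_ : (fun t => expR (- d * t) * - y (h *m J) t) =
      fun t => -1 * (expR (- d * t) * y (h *m J) t)); last first.
    by apply/funext => t; rewrite mulN1r mulrN.
  by rewrite RintegralZl// mulN1r addNr addr0.
have [dG dGE] : differentiable (flow_laplace phi w d \o cinv a) x0 /\
    'd (flow_laplace phi w d \o cinv a) x0 = row_pairing l :> (_ -> _).
  apply: differentiable_littleo; first exact: row_pairing_continuous.
  move=> e e0; apply: near0_seqP => h h0.
  apply: contrapT => /forallNP hn.
  (* Shifting by [N] puts every term in the ball of radius [r], so that the Lipschitz bound [uL]
     holds for all indices. *)
  have [N _ hN] := h0 r r0.
  pose k n := h (n + N)%N.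
  have kr n : `|k n| < r by apply: hN => /=; rewrite leq_addl.
  have k0 rr : 0 < rr -> \forall n \near \oo, `|k n| < rr.
    move=> /h0[N' _ hN']; exists N' => // n /= nN; apply: hN' => /=.
    exact: leq_trans nN (leq_addr _ _).
  (* The estimate is trivial at 0, so a sequence violating it has no zero term and can be divided by
     its norm. *)
  have kgt0 n : 0 < `|k n|.
    rewrite normr_gt0; apply/eqP => kn0; apply: (hn (n + N)%N).
    rewrite -/(k n) kn0 add0r subrr sub0r normr0 mulr0 linear0 oppr0 normr0.
    exact: lexx.
  (* The first-order remainder divided by [|k n|]; it tends to 0 pointwise because each [u t] is
     differentiable at [x0]. *)
  pose f_ n t := `|k n|^-1 * (expR (- d * t) * (u t (k n + x0) - u t x0 - y (k n) t)).
  have cf n : continuous (f_ n).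
    move=> t; apply: cvgMr; apply: cvgM; first exact: continuous_expRM.
    apply: cvgB; last exact: orbit_slope_continuous.
    by apply: cvgB; exact: orbit_continuous.
  have intf n : \int[mu]_(t in `[0, +oo[) f_ n t = `|k n|^-1 *
      (flow_laplace phi w d (cinv a (k n + x0)) -
       flow_laplace phi w d (cinv a x0) - row_pairing l (k n)).
    pose F1 t := expR (- d * t) * u t (k n + x0).
    pose F2 t := expR (- d * t) * u t x0.
    pose F3 t := expR (- d * t) * y (k n) t.
    have i1 : mu.-integrable `[0, +oo[ (EFin \o F1) by exact: integrable_orbit.
    have i2 : mu.-integrable `[0, +oo[ (EFin \o F2) by exact: integrable_orbit.
    have i3 : mu.-integrable `[0, +oo[ (EFin \o F3) by exact: iy.
    have i12 : mu.-integrable `[0, +oo[ (EFin \o (fun t => F1 t - F2 t)).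
      exact: (integrableB _ i1 i2).
    have i123 : mu.-integrable `[0, +oo[ (EFin \o (fun t => F1 t - F2 t - F3 t)).
      exact: (integrableB _ i12 i3).
    transitivity (`|k n|^-1 * \int[mu]_(t in `[0, +oo[) (F1 t - F2 t - F3 t)).
      rewrite -RintegralZl//; apply: eq_Rintegral => t _.
      by rewrite /f_ /F1 /F2 /F3 !mulrBr.
    by rewrite -ellE RintegralB// RintegralB.
  have lim : \int[mu]_(t in `[0, +oo[) f_ n t @[n --> \oo] -->
      \int[mu]_(t in `[0, +oo[) (cst (0 : R)) t.
    (* The increment of [u t] and its linear part each contribute [B * expR (b * t)] after division
       by [|k n|], hence the factor 2. *)
    apply: (@Rintegral_dominated_cvg _ _ _ _
      (fun t => 2 * B * expR (- (d - b) * t))) => //.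
    - by move=> n; apply: measurable_funTS; exact: continuous_measurable_fun.
    - move=> t /=; rewrite in_itv/= andbT => t0.
      have dut : differentiable (u t) x0.
        by have [_ ? _] := ub t x0 t0 (ballxx x0 r0).
      apply/cvgrPdist_le => /= e' e'0.
      have /nbhs_ballP[p /= p0 pu] := differentiable_approx dut e'0.
      near=> n; rewrite sub0r normrN /f_ normrM normfV normr_id.
      rewrite ler_pdivrMl// normrM ger0_norm ?expR_ge0//.
      apply: le_trans (_ : 1 * `|u t (k n + x0) - u t x0 - y (k n) t| <= _).
        by rewrite ler_wpM2r// expR_le1 mulNr oppr_le0 mulr_ge0// ltW.
      rewrite mul1r mulrC -yE; apply: pu.
      rewrite -ball_normE/= sub0r normrN; near: n; exact: k0.
    - have db0 : 0 < d - b by rewrite subr_gt0.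
      exact: (integrableZl _ (2 * B) (integrable_expR_decay db0)).
    - move=> n t /=; rewrite in_itv/= andbT => t0.
      rewrite /f_ normrM normfV normr_id ler_pdivrMl//.
      rewrite normrM ger0_norm ?expR_ge0//.
      apply: le_trans (_ : expR (- d * t) *
          (B * expR (b * t) * `|k n| + B * `|k n| * expR (b * t)) <= _).
        rewrite ler_wpM2l ?expR_ge0// (le_trans (ler_normB _ _))//.
        by apply: lerD; [exact: uL|exact: yB].
      rewrite (_ : - (d - b) * t = - d * t + b * t); last by ring.
      by rewrite expRD le_eqVlt; apply/orP; left; apply/eqP; ring.
  move: lim; rewrite /cst Rintegral_cst0 => /cvgrPdist_lt /(_ e e0)[n0 _].
  move=> /(_ n0 (leqnn n0)); rewrite /= sub0r normrN intf normrM normfV normr_id.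
  rewrite ltr_pdivrMl// mulrC => lte.
  exact: (hn (n0 + N)%N (ltW lte)).
by split => // h; exact: (congr1 (@^~ h) dGE).
Unshelve. all: by end_near. Qed.

End LaplaceOrbit.

(** * Bump functions *)

Section PosSquare.
Variable R : realType.

(** A cutoff of class C^1, the regularity asked of test functions; its derivative 2 max(0, s) is
    Lipschitz, whence the quadratic remainder below. *)
Definition possq (s : R) : R := (Num.max 0 s) ^+ 2.

Lemma possq_taylor (s t : R) :
  `|possq (t + s) - possq s - 2 * Num.max 0 s * t| <= t ^+ 2.
Proof.
rewrite /possq ler_norml; case: (ltP 0 s) => s0; case: (ltP 0 (t + s)) => ts0;
  apply/andP; split; nra.
Qed.

End PosSquare.

Section Euclid.
Variables (R : realType) (q : nat).
Implicit Types (x c h : 'rV[R]_q).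

(** The Euclidean square replaces the norm of row vectors, a max norm, which is not
    differentiable. *)
Definition sqdist c x : R := \sum_i (x 0 i - c 0 i) ^+ 2.

Definition bell c (r : R) x : R := possq (r ^+ 2 - sqdist c x).

(** The gradient of [bell]: the factor -4 is the 2 from the square times the -2 from [- sqdist]. *)
Definition bell_slope c (r : R) x : 'cV[R]_q :=
  (- 4 * Num.max 0 (r ^+ 2 - sqdist c x)) *: (x - c)^T.

Lemma sqdist_taylor c x h :
  sqdist c (h + x) = sqdist c x + 2 * row_pairing (x - c)^T h + sqdist 0 h.
Proof.
rewrite /sqdist /row_pairing mxE mulr_sumr -!big_split/=; apply: eq_bigr => i _.
by rewrite !mxE; ring.
Qed.

Lemma sqdist_ge0 c x : 0 <= sqdist c x.
Proof. by apply: sumr_ge0 => i _; exact: sqr_ge0. Qed.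

Lemma sqdist0_le h : sqdist 0 h <= q%:R * `|h| ^+ 2.
Proof.
rewrite /sqdist; apply: le_trans (ler_sum _ (G := fun _ => `|h| ^+ 2) _) _.
  move=> i _; rewrite mxE subr0 -[h 0 i ^+ 2]real_normK ?num_real//.
  by rewrite lerXn2r ?nnegrE// normr_entry.
by rewrite sumr_const card_ord mulr_natl.
Qed.

Lemma sqdist_lt_norm c x (r : R) : 0 < r -> sqdist c x < r ^+ 2 -> `|x - c| <= r.
Proof.
move=> r0 xr; apply: normr_mx_le; first exact: ltW.
move=> i j; rewrite ord1 -(@ler_sqr _ `|_|) ?nnegrE//; last exact: ltW.
rewrite real_normK ?num_real// (le_trans _ (ltW xr))// /sqdist (bigD1 j)//= !mxE.
by rewrite lerDl sumr_ge0// => k _; exact: sqr_ge0.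
Qed.

Lemma bell_supp c (r : R) x : 0 < r -> r < `|x - c| -> bell c r x = 0.
Proof.
move=> r0 xr; have : ~~ (sqdist c x < r ^+ 2).
  by apply/negP => /(sqdist_lt_norm r0); rewrite leNgt xr.
rewrite -leNgt -subr_le0 => h; rewrite /bell /possq.
by rewrite max_l// expr0n.
Qed.

Lemma row_pairing_le (l : 'cV[R]_q) h : `|row_pairing l h| <= q%:R * `|l| * `|h|.
Proof.
rewrite /row_pairing mxE; apply: le_trans (ler_norm_sum _ _ _) _.
apply: le_trans (ler_sum _ (G := fun _ => `|l| * `|h|) _) _.
  by move=> i _; rewrite normrM mulrC ler_pM ?normr_entry.
by rewrite sumr_const card_ord -mulrA mulr_natl.
Qed.

Lemma bell_diff c (r : R) x : differentiable (bell c r) x /\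
  'd (bell c r) x = row_pairing (bell_slope c r x) :> (_ -> _).
Proof.
apply: differentiable_littleo; first exact: row_pairing_continuous.
move=> e e0.
pose A := q%:R * `|(x - c)^T| * 2 : R.
pose B := 2 * Num.max 0 (r ^+ 2 - sqdist c x).
have A0 : 0 <= A by rewrite !mulr_ge0.
have B0 : 0 <= B by rewrite mulr_ge0// le_max lexx.
(* Collects the quadratic errors: the square of [|t| <= (A + q) |h|] from [possq_taylor], and the
   second-order part [B * sqdist 0 h] of the inner function. *)
pose D := (A + q%:R) ^+ 2 + B * q%:R + 1.
have D0 : 0 < D by rewrite ltr_wpDl// addr_ge0 ?sqr_ge0// mulr_ge0.
have m0 : 0 < Num.min 1 (e / D) by rewrite lt_min ltr01 divr_gt0.
have hn := @near0_norm_lt R 'rV[R]_q _ m0.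
move: hn; apply: filterS => h; rewrite lt_min => /andP[h1 he].
pose t := - (2 * row_pairing (x - c)^T h + sqdist 0 h).
have -> : bell c r (h + x) = possq (t + (r ^+ 2 - sqdist c x)).
  by rewrite /bell sqdist_taylor /t; congr possq; ring.
rewrite -[X in _ - X]/(row_pairing (bell_slope c r x) h).
have -> : row_pairing (bell_slope c r x) h =
    2 * Num.max 0 (r ^+ 2 - sqdist c x) * t + B * sqdist 0 h.
  rewrite /t /B /bell_slope /row_pairing -scalemxAr mxE.
  by move: ((h *m _) 0 0) => z; ring.
have ht : `|t| <= (A + q%:R) * `|h|.
  rewrite /t normrN (le_trans (ler_normD _ _))// [leRHS]mulrDl lerD//.
    by rewrite normrM ger0_norm// [leLHS]mulrC /A mulrAC ler_wpM2r// row_pairing_le.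
  rewrite ger0_norm ?sqdist_ge0// (le_trans (sqdist0_le h))// ler_wpM2l//.
  by rewrite expr2 ler_piMl// ltW.
have := possq_taylor (r ^+ 2 - sqdist c x) t.
rewrite -/(bell c r x) => tay.
rewrite opprD addrA (le_trans (ler_normB _ _))//.
apply: le_trans (lerD tay (lexx _)) _.
rewrite normrM !ger0_norm ?sqdist_ge0//.
have t2 : t ^+ 2 <= (A + q%:R) ^+ 2 * `|h| ^+ 2.
  by rewrite -exprMn -(real_normK (num_real t)) lerXn2r ?nnegrE// mulr_ge0// addr_ge0.
apply: le_trans (_ : D * `|h| ^+ 2 <= _).
  rewrite /D 2!mulrDl mul1r -addrA; apply: lerD => //.
  apply: le_trans (_ : B * (q%:R * `|h| ^+ 2) <= _).
    by rewrite ler_wpM2l// sqdist0_le.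
  by rewrite mulrA lerDl sqr_ge0.
rewrite expr2 mulrA ler_wpM2r// mulrC.
by rewrite -ler_pdivlMr// ltW.
Qed.

Lemma sqdist_continuous c : continuous (sqdist c).
Proof.
move=> x; have FF : Filter (nbhs x) by exact: nbhs_filter.
rewrite /continuous_at /sqdist; apply: cvg_big => [|i _]; first exact: add_continuous.
have h : (fun y : 'rV[R]_q => y 0 i - c 0 i) @ x --> x 0 i - c 0 i.
  by apply: cvgB; [exact: coord_continuous|exact: cvg_cst].
by rewrite expr2; under eq_fun do rewrite expr2; exact: cvgM.
Qed.

Lemma bell_slope_le c (r : R) x : 0 < r ->
  `|bell_slope c r x| <= 4 * r ^+ 2 * r.
Proof.
move=> r0; rewrite /bell_slope.
have [xr|xr] := ltP (sqdist c x) (r ^+ 2); last first.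
  rewrite max_l ?subr_le0// mulr0 scale0r normr0.
  by rewrite !mulr_ge0 ?sqr_ge0// ltW.
have xr0 : 0 <= r ^+ 2 - sqdist c x by rewrite subr_ge0 ltW.
rewrite max_r// normrZ normrM normrN !ger0_norm//.
have xc : `|(x - c)^T| <= r.
  apply: normr_mx_le; first exact: ltW.
  move=> i j; rewrite mxE; apply: le_trans (normr_entry _ _ _) _.
  exact: sqdist_lt_norm.
rewrite ler_pM// ?mulr_ge0//.
by rewrite ler_wpM2l// lerBlDr lerDl sqdist_ge0.
Qed.

Lemma bell_slope_supp c (r : R) x : 0 < r -> r < `|x - c| -> bell_slope c r x = 0.
Proof.
move=> r0 xr; have : ~~ (sqdist c x < r ^+ 2).
  by apply/negP => /(sqdist_lt_norm r0); rewrite leNgt xr.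
rewrite -leNgt -subr_le0 => h; rewrite /bell_slope max_l// mulr0 scale0r//.
Qed.

Lemma bell_le c (r : R) x : `|bell c r x| <= (r ^+ 2) ^+ 2.
Proof.
rewrite /bell /possq ger0_norm ?sqr_ge0// lerXn2r ?nnegrE ?sqr_ge0 ?le_max ?lexx//.
by rewrite ge_max sqr_ge0/= lerBlDr lerDl sqdist_ge0.
Qed.

End Euclid.

(** The formula [F] for the derivative may change with the point; a bump has one inside its chart
    and vanishes near points outside. *)
Lemma Ck1_intro (R : realType) (E W : normedModType R) (U : set E) (f : E -> W) :
  (forall x, U x -> differentiable f x) ->
  (forall x v, U x -> exists2 F : E -> W, {for x, continuous F} &
     \forall y \near x, 'D_v f y = F y) ->
  Ck_on 1 U f.
Proof.
move=> df cf; split => // v x Ux; have [F cF fF] := cf x v Ux.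
rewrite /prop_for /continuous_at (nbhs_singleton fF).
apply: cvg_trans cF; apply: near_eq_cvg.
by move: fF; apply: filterS => y ->.
Qed.

Section Bump.
Variables (R : realType) (q : nat) (M : manifold R q).
Implicit Types (b : chart R q M) (x c : 'rV[R]_q).

Lemma cimg_near b x : cimg b x -> \forall y \near x, cimg b y.
Proof.
by move=> bx; apply: open_nbhs_nbhs; split => //; exact: cimg_open.
Qed.

Definition bump_fun (a : chart R q M) c (r : R) (n : M) : R :=
  if n \in cdom a then bell c r (cmap a n) else 0.

Variables (a : chart R q M) (c : 'rV[R]_q) (r r1 : R).
Hypothesis a_atlas : atlas a.
Hypothesis r_gt0 : 0 < r.
Hypothesis r_lt : r < r1.
Hypothesis ball_img : forall x, `|x - c| < r1 -> cimg a x.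
Let w := bump_fun a c r.

Lemma bump_in n : cdom a n -> w n = bell c r (cmap a n).
Proof. by move=> an; rewrite /w /bump_fun mem_set. Qed.

(** The support lies in a closed coordinate ball, whose image is closed in [M] and contained in the
    chart. This makes the extension by zero as regular as the bump itself. *)
Lemma bump_near0 n : ~ cdom a n -> \forall k \near n, w k = 0.
Proof.
move=> an; pose S := cinv a @` [set x | `|x - c| <= r].
have cS : closed S by exact: (compact_chart_ball ball_img r_lt).
have : \forall k \near n, ~ S k.
  apply: open_nbhs_nbhs; split; first exact: closed_openC.
  move=> [x /= xr xn]; apply: an; rewrite -xn; apply: cdom_cinv.
  exact/ball_img/(le_lt_trans xr).
apply: filterS => k Sk; rewrite /w /bump_fun; case: ifPn => // /set_mem ak.
apply: bell_supp => //; rewrite ltNge; apply/negP => kr; apply: Sk.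
by exists (cmap a k) => //; rewrite cmapK.
Qed.

Lemma bump_far n : cdom a n -> r < `|cmap a n - c| -> w n = 0.
Proof. by move=> an nr; rewrite bump_in// bell_supp. Qed.

Lemma bump_chart b x : atlas b -> cimg b x -> cdom a (cinv b x) ->
  differentiable (w \o cinv b) x /\ forall h, 'd (w \o cinv b) x h =
    row_pairing (bell_slope c r (cmap a (cinv b x)))
      ('d (cmap a \o cinv b) x h).
Proof.
move=> ab bx ax; pose T := cmap a \o cinv b.
have dT : differentiable T x by exact: transition_differentiable.
have [dbell dbellE] := bell_diff c r (T x).
have [|| d dE] := @near_eq_diff R _ _ (w \o cinv b) (bell c r \o T) x.
- have := chart_near (cinv_cont bx) ax; apply: filterS => y ay /=.
  by rewrite bump_in.
- exact: differentiable_comp.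
split => // h; rewrite (congr1 (@^~ h) dE) (congr1 (@^~ h) (diff_comp dT dbell)).
exact: (congr1 (@^~ ('d T x h)) dbellE).
Qed.

Lemma bump_chart_near0 b x : cimg b x -> ~ cdom a (cinv b x) ->
  \forall y \near x, (w \o cinv b) y = (cst 0 : _ -> R) y.
Proof. by move=> bx ax; exact: (cinv_cont bx (bump_near0 ax)). Qed.

Lemma coord_cvg (T : 'rV[R]_q -> 'rV[R]_q) x i : {for x, continuous T} ->
  (fun y => T y 0 i) @ x --> T x 0 i.
Proof.
move=> cT; have := @continuous_comp _ _ _ T (fun z : 'rV[R]_q => z 0 i) x cT.
by apply; exact: coord_continuous.
Qed.

Lemma bell_pairing_cvg (T DT : 'rV[R]_q -> 'rV[R]_q) x :
  {for x, continuous T} -> {for x, continuous DT} ->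
  {for x, continuous (fun y => row_pairing (bell_slope c r (T y)) (DT y))}.
Proof.
move=> cT cDT; have FF : Filter (nbhs x) by exact: nbhs_filter.
have ci i : (fun y => DT y 0 i * (T y 0 i - c 0 i)) @ x -->
    DT x 0 i * (T x 0 i - c 0 i).
  apply: cvgM; first exact: coord_cvg.
  by apply: cvgB; [exact: coord_cvg|exact: cvg_cst].
(* The maximum is written through an absolute value, so that continuity reduces to that of the
   norm. *)
rewrite (_ : (fun y => _) = (fun y => (- 4 *
    ((0 + (r ^+ 2 - sqdist c (T y)) + `|0 - (r ^+ 2 - sqdist c (T y))|) / 2)) *
    \sum_i (DT y 0 i * (T y 0 i - c 0 i)))); last first.
  apply/funext => y; rewrite /row_pairing /bell_slope -scalemxAr mxE maxr_absE.
  by congr (_ * _); rewrite mxE; apply: eq_bigr => i _; rewrite !mxE.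
have cs : (fun y => r ^+ 2 - sqdist c (T y)) @ x --> r ^+ 2 - sqdist c (T x).
  apply: cvgB; first exact: cvg_cst.
  by apply: continuous_comp => //; exact: sqdist_continuous.
apply: cvgM.
  apply: cvgMr; apply: cvgMl; apply: cvgD.
    by apply: cvgD => //; exact: cvg_cst.
  by apply: cvg_norm; apply: cvgB => //; exact: cvg_cst.
by apply: cvg_big => [|i _]; [exact: add_continuous|exact: ci].
Qed.

Lemma bump_C1 : C1_fun w.
Proof.
move=> b ab; apply: Ck1_intro.
  move=> x bx; have [ax|ax] := pselect (cdom a (cinv b x)).
    by have [] := bump_chart ab bx ax.
  have d0 : differentiable (cst 0 : 'rV[R]_q -> R) x by exact: differentiable_cst.
  by have [] := near_eq_diff (bump_chart_near0 bx ax) d0.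
move=> x v bx; have [ax|ax] := pselect (cdom a (cinv b x)); last first.
  exists (cst 0); first exact: cst_continuous.
  (* Vanishing near [x] is vanishing near every [y] close to [x], so the derivative is zero on a
     whole neighbourhood. *)
  have /nbhs_interior := bump_chart_near0 bx ax.
  apply: filterS => y yw.
  have d0 : differentiable (cst 0 : 'rV[R]_q -> R) y by exact: differentiable_cst.
  have [dw dwE] := near_eq_diff yw d0.
  by rewrite deriveE// (congr1 (@^~ v) dwE) (congr1 (@^~ v) (diff_cst _ _)).
pose T := cmap a \o cinv b.
have bax : (cmap b @` (cdom b `&` cdom a)) x.
  by exists (cinv b x); [split => //; exact: cdom_cinv|exact: cinvK].
exists (fun y => row_pairing (bell_slope c r (T y)) ('D_v T y)).
  apply: bell_pairing_cvg.
    by apply: differentiable_continuous; exact: transition_differentiable.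
  by have [_ /(_ v x bax)] := atlas_smooth ab a_atlas 1.
have nb := cimg_near bx; have na := chart_near (cinv_cont bx) ax.
near=> y; have yb : cimg b y by near: y; exact: nb.
have ya : cdom a (cinv b y) by near: y; exact: na.
have [d dE] := bump_chart ab yb ya.
have dT : differentiable T y by exact: transition_differentiable.
by rewrite !deriveE// dE.
Unshelve. all: by end_near. Qed.

Lemma bump_tdiff m v : a = chart_at m ->
  tdiff w m v = row_pairing (bell_slope c r (base_coord m)) v.
Proof.
move=> am; have ma : atlas (chart_at m) := chart_at_atlas m.
have ax : cdom a (cinv (chart_at m) (base_coord m)).
  by rewrite base_coordK am; exact: chart_at_dom.
have [_ dE] := bump_chart ma (base_coord_img m) ax.
apply: (etrans (dE v)); rewrite base_coordK am -/(base_coord m).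
congr row_pairing; have := frame_base m v.
by rewrite /frame base_coordK.
Qed.

End Bump.

Section BumpBounded.
Variables (R : realType) (q : nat) (M : manifold R q) (g : riemannian M).

Lemma diff_chart_id (c : chart R q M) x v : cimg c x ->
  'd (cmap c \o cinv c) x v = v.
Proof.
move=> cx; have d : differentiable (id : 'rV[R]_q -> 'rV[R]_q) x by exact: ex_diff.
have n : \forall y \near x, (cmap c \o cinv c) y = id y.
  by have := cimg_near cx; apply: filterS => y /cinvK.
have [_ dE] := near_eq_diff n d.
apply: (etrans (congr1 (@^~ v) dE)).
exact: (congr1 (@^~ v) diff_val).
Qed.

Lemma transition_inv (b c : chart R q M) x v : atlas b -> atlas c ->
  cimg c x -> cdom b (cinv c x) ->
  'd (cmap c \o cinv b) (cmap b (cinv c x)) ('d (cmap b \o cinv c) x v) = v.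
Proof.
move=> ab ac cx bx.
have bn : cimg b (cmap b (cinv c x)) by exists (cinv c x).
have cn : cdom c (cinv b (cmap b (cinv c x))).
  by rewrite cmapK; [exact: cdom_cinv|exact: bx].
have [_ dE] := diff_change_chart ac ab cx bx (transition_differentiable ab ac bn cn).
exact: (etrans (esym (dE v)) (diff_chart_id v cx)).
Qed.

(** Gives a tangent vector at [cinv a x] its coordinates in [a], so that it can be measured by the
    coordinate norm. *)
Lemma frame_surj (a : chart R q M) x v : atlas a -> cimg a x ->
  frame a x ('d (cmap a \o cinv (chart_at (cinv a x))) (base_coord (cinv a x)) v)
    = v.
Proof.
move=> aa ax; set n := cinv a x; have ac := chart_at_atlas n.
have an : cdom a (cinv (chart_at n) (base_coord n)).
  by rewrite base_coordK; exact: cdom_cinv.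
have E : cmap a (cinv (chart_at n) (base_coord n)) = x.
  by rewrite base_coordK cinvK.
exact: (eq_ind _ (fun z => 'd (cmap (chart_at n) \o cinv a) z _ = v)
  (transition_inv v aa ac (base_coord_img n) an) _ E).
Qed.

(** On the support, unit tangent vectors have coordinates of size at most 1/k, so Dw is bounded;
    elsewhere it vanishes. [r0] is uniform in the centre [c], which leaves room to move the bump off
    the base point. *)
Lemma bump_bounded (m : M) : exists r0 : R, [/\ 0 < r0,
  forall x, `|x - base_coord m| < r0 -> cimg (chart_at m) x &
  forall c (r : R), 0 < r -> `|c - base_coord m| + r < r0 ->
    bounded_C1 g (bump_fun (chart_at m) c r)].
Proof.
have [k [L [r0 [k0 _ r00 bd]]]] := tangent_norm_frame_bounds g m.
set a := chart_at m in bd *; set x0 := base_coord m in bd *.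
have img x : `|x - x0| < r0 -> cimg a x.
  by move=> xr; have [] := bd x; rewrite // -ball_normE/= distrC.
exists r0; split => // c r rpos cr.
pose r1 := r0 - `|c - x0|.
have rr1 : r < r1 by rewrite /r1 ltrBrDr addrC.
have img1 x : `|x - c| < r1 -> cimg a x.
  move=> xc; apply: img; rewrite -(subrK c x) -addrA.
  by rewrite (le_lt_trans (ler_normD _ _))// -ltrBrDr.
have aa : atlas a := chart_at_atlas m.
set w := bump_fun a c r.
have w1 : C1_fun w := bump_C1 aa rpos rr1 img1.
split => //.
  apply: (@le_lt_trans _ _ (((r ^+ 2) ^+ 2)%:E)); last exact: ltry.
  apply: ub_ereal_sup => _ [n _ <-]; rewrite lee_fin /w /bump_fun.
  by case: ifPn => _; rewrite ?bell_le// normr0 sqr_ge0.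
pose C := q%:R * (4 * r ^+ 2 * r) * k^-1.
have ki0 : 0 <= k^-1 by rewrite invr_ge0 ltW.
have C0 : 0 <= C by rewrite !mulr_ge0 ?sqr_ge0// ltW.
apply: (@le_lt_trans _ _ C%:E); last exact: ltry.
apply: ub_ereal_sup => _ [n _ <-].
apply: ub_ereal_sup => _ [v v1 <-]; rewrite lee_fin.
have [an|an] := pselect (cdom a n); last first.
  have an' : ~ cdom a (cinv (chart_at n) (base_coord n)) by rewrite base_coordK.
  have nz := bump_chart_near0 rpos rr1 img1 (base_coord_img n) an'.
  have d0 : differentiable (cst 0 : 'rV[R]_q -> R) (base_coord n).
    exact: differentiable_cst.
  have [_ dE] := near_eq_diff nz d0.
  have -> : tdiff w n v = 0.
    by rewrite [LHS](congr1 (@^~ v) dE) (congr1 (@^~ v) (diff_cst _ _)).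
  by rewrite normr0.
pose x := cmap a n; have ax : cimg a x by exists n.
have xn : cinv a x = n by rewrite /x cmapK.
have [_ dE] := diff_C1_fun w1 aa ax.
have an' : cdom a (cinv a x) by rewrite xn.
have [_ bE] := bump_chart c r aa aa ax an'.
pose h := 'd (cmap a \o cinv (chart_at (cinv a x))) (base_coord (cinv a x)) v.
have fh : frame a x h = v := frame_surj v aa ax.
have wh : tdiff w n v = row_pairing (bell_slope c r x) h.
  rewrite -fh -xn; apply: (etrans (esym (dE h))); apply: (etrans (bE h)).
  by rewrite xn diff_chart_id.
rewrite wh.
have [far|close] := ltP r `|x - c|.
  by rewrite bell_slope_supp// /row_pairing mulmx0 mxE normr0.
have [|_ /(_ h)/andP[hk _]] := bd x.
  rewrite -ball_normE/= distrC -(subrK c x) -addrA.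
  apply: le_lt_trans (ler_normD _ _) _; apply: le_lt_trans cr.
  by rewrite [leLHS]addrC lerD2l.
have hle : `|h| <= k^-1.
  by rewrite -[leRHS]mulr1 ler_pdivlMl// (le_trans hk)// fh xn.
apply: le_trans (row_pairing_le _ _) _.
by rewrite /C ler_pM// ?mulr_ge0// ler_wpM2l// bell_slope_le.
Qed.

End BumpBounded.

(** * The C^1 norm and open dense conditions *)

Section C1Space.
Variables (R : realType) (q : nat) (M : manifold R q) (g : riemannian M).
Implicit Types w : M -> R.

(** Real bounds in place of the extended-real suprema, so that estimates are added and scaled in
    [R]. *)
Definition C1_bound w (s t : R) : Prop := (forall m, `|w m| <= s) /\
  forall m v, tangent_norm g m v <= 1 -> `|tdiff w m v| <= t.

Lemma C1_norm_le w s t : C1_bound w s t -> (C1_norm g w <= (s + t)%:E)%E.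
Proof.
move=> [ws wt]; rewrite EFinD; apply: leeD.
  by apply: ub_ereal_sup => _ [n _ <-]; rewrite lee_fin.
apply: ub_ereal_sup => _ [n _ <-].
by apply: ub_ereal_sup => _ [v v1 <-]; rewrite lee_fin; exact: wt.
Qed.

Lemma sup_norm_bound w (s : R) : (sup_norm w <= s%:E)%E -> forall m, `|w m| <= s.
Proof.
move=> ws m; rewrite -lee_fin (le_trans _ ws)//.
by apply: ereal_sup_ubound; exists m.
Qed.

Lemma sup_tdiff_bound w (t : R) : (sup_tdiff_norm g w <= t%:E)%E ->
  forall m v, tangent_norm g m v <= 1 -> `|tdiff w m v| <= t.
Proof.
move=> wt m v v1; rewrite -lee_fin (le_trans _ wt)//.
apply: (@le_trans _ _ (tdiff_norm g w m)); last first.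
  by apply: ereal_sup_ubound; exists m.
by apply: ereal_sup_ubound; exists v.
Qed.

Lemma bounded_C1P w : bounded_C1 g w ->
  exists s t : R, [/\ 0 <= s, 0 <= t & C1_bound w s t].
Proof.
move=> [_ /lty_real_ub[s s0 ws] /lty_real_ub[t t0 wt]]; exists s, t; split => //.
by split; [exact: sup_norm_bound|exact: sup_tdiff_bound].
Qed.

Lemma C1_bound_bounded w s t : C1_fun w -> C1_bound w s t -> bounded_C1 g w.
Proof.
move=> w1 [ws wt]; split => //.
  apply: (@le_lt_trans _ _ s%:E); last exact: ltry.
  by apply: ub_ereal_sup => _ [n _ <-]; rewrite lee_fin.
apply: (@le_lt_trans _ _ t%:E); last exact: ltry.
apply: ub_ereal_sup => _ [n _ <-].
by apply: ub_ereal_sup => _ [v v1 <-]; rewrite lee_fin; exact: wt.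
Qed.

(** The point [m0] makes both suprema nonnegative (over an empty manifold they are -oo), and a sum
    below [e] then makes both finite. *)
Lemma C1_norm_lt (m0 : M) w (e : R) : (C1_norm g w < e%:E)%E ->
  exists s t : R, [/\ 0 <= s, 0 <= t, s + t < e & C1_bound w s t].
Proof.
have s0 : (0 <= sup_norm w)%E.
  apply: (@le_trans _ _ `|w m0|%:E); first by rewrite lee_fin.
  by apply: ereal_sup_ubound; exists m0.
have t0 : (0 <= sup_tdiff_norm g w)%E.
  apply: (@le_trans _ _ (tdiff_norm g w m0)); last first.
    by apply: ereal_sup_ubound; exists m0.
  apply: (@le_trans _ _ `|tdiff w m0 0|%:E); first by rewrite lee_fin.
  apply: ereal_sup_ubound; exists 0 => //=.
  by rewrite /tangent_norm !mul0mx mxE sqrtr0.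
rewrite /C1_norm; move: s0 t0.
case sE : (sup_norm w) => [s| |]//; case tE : (sup_tdiff_norm g w) => [t| |]//.
rewrite !lee_fin -EFinD lte_fin => s0 t0 ste; exists s, t; split => //; split.
  by apply: sup_norm_bound; rewrite sE.
by apply: sup_tdiff_bound; rewrite tE.
Qed.

Lemma tdiff_lin w w0 (s : R) m v : C1_fun w -> C1_fun w0 ->
  tdiff (fun n => w n + s * w0 n) m v = tdiff w m v + s * tdiff w0 m v.
Proof.
move=> w1 w01; set a := chart_at m; set x0 := base_coord m.
have d1 : differentiable (w \o cinv a) x0.
  by have [+ _] := w1 _ (chart_at_atlas m); apply; exact: base_coord_img.
have d2 : differentiable (w0 \o cinv a) x0.
  by have [+ _] := w01 _ (chart_at_atlas m); apply; exact: base_coord_img.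
have d3 : differentiable (s *: (w0 \o cinv a)) x0 by exact: differentiableZ.
have := congr1 (@^~ v) (diffD d1 d3); rewrite /= => dE.
apply: (etrans dE); congr (_ + _).
exact: (congr1 (@^~ v) (diffZ s d2)).
Qed.

Lemma continuous_lin (E : normedModType R) (f h : E -> R) (x : E) (s : R) :
  {for x, continuous f} -> {for x, continuous h} ->
  {for x, continuous (fun y => f y + s * h y)}.
Proof. by move=> cf ch; exact: (cvgD cf (cvgMr ch)). Qed.

Lemma C1_fun_lin w w0 (s : R) : C1_fun w -> C1_fun w0 ->
  C1_fun (fun n => w n + s * w0 n).
Proof.
move=> w1 w01 b ab; have [d1 c1] := w1 b ab; have [d2 c2] := w01 b ab.
apply: Ck1_intro => x.
  by move=> bx; apply: differentiableD; [exact: d1|apply: differentiableZ; exact: d2].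
move=> v bx; exists (fun y => 'D_v (w \o cinv b) y + s * 'D_v (w0 \o cinv b) y).
  exact: (@continuous_lin _ _ _ _ s (c1 v x bx) (c2 v x bx)).
have := cimg_near bx; apply: filterS => y yb.
have e1 : derivable (w \o cinv b) y v by apply: diff_derivable; exact: d1.
have e2 : derivable (w0 \o cinv b) y v by apply: diff_derivable; exact: d2.
have := deriveD e1 (@derivableZ _ _ _ _ s _ _ e2).
by rewrite (@deriveZ _ _ _ _ s _ _ e2).
Qed.

Lemma C1_bound_lin w w0 (c s t s0 t0 : R) : C1_fun w -> C1_fun w0 ->
  C1_bound w s t -> C1_bound w0 s0 t0 ->
  C1_bound (fun n => w n + c * w0 n) (s + `|c| * s0) (t + `|c| * t0).
Proof.
move=> w1 w01 [ws wt] [ws0 wt0]; split.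
  move=> m; rewrite (le_trans (ler_normD _ _))// lerD// normrM ler_wpM2l//.
move=> m v v1; rewrite tdiff_lin// (le_trans (ler_normD _ _))//.
by apply: lerD; [exact: wt|rewrite normrM ler_wpM2l//; exact: wt0].
Qed.

Lemma bounded_C1_lin w w0 (c : R) : bounded_C1 g w -> bounded_C1 g w0 ->
  bounded_C1 g (fun n => w n + c * w0 n).
Proof.
move=> bw bw0; have [w1 _ _] := bw; have [w01 _ _] := bw0.
have [s [t [_ _ wst]]] := bounded_C1P bw.
have [s0 [t0 [_ _ w0st]]] := bounded_C1P bw0.
exact: (C1_bound_bounded (C1_fun_lin c w1 w01) (C1_bound_lin c w1 w01 wst w0st)).
Qed.

Lemma subf_lin w w' : w' \- w = fun n => w' n + -1 * w n.
Proof. by apply/funext => n; rewrite mulN1r. Qed.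

Lemma C1_fun_sub w w' : C1_fun w -> C1_fun w' -> C1_fun (w' \- w).
Proof. by move=> w1 w'1; rewrite subf_lin; exact: C1_fun_lin. Qed.

End C1Space.

Section GenericNonzero.
Variables (R : realType) (q : nat) (M : manifold R q) (g : riemannian M).
(** [pt] supplies the point of [M] that [C1_norm_lt] asks for. *)
Variables (I : eqType) (pt : I -> M) (L : I -> (M -> R) -> R).
Hypothesis L_cont : forall i, exists2 C : R, 0 <= C &
  forall w w' (s t : R), bounded_C1 g w -> bounded_C1 g w' ->
    C1_bound g (w' \- w) s t -> `|L i w' - L i w| <= C * (s + t).
Hypothesis L_nonzero : forall i, exists w0, [/\ bounded_C1 g w0, L i w0 != 0 &
  forall w (c : R), bounded_C1 g w ->
    L i (fun n => w n + c * w0 n) = L i w + c * L i w0].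

Definition nonzero_on (l : seq I) : set (M -> R) :=
  [set w | bounded_C1 g w /\ {in l, forall i, L i w != 0}].

Lemma nonzero_on_open l : C1_open g (nonzero_on l).
Proof.
split; first by move=> w [].
elim: l => [|i l IH] w [bw Lw].
  by exists 1; [exact: ltr01|move=> w' [bw' _]; split; [exact: bw'|move=> j]].
have [|e e0 eO] := IH w.
  by split => // j jl; apply: Lw; rewrite inE jl orbT.
have [C C0 LC] := L_cont i.
have Li0 : 0 < `|L i w| by rewrite normr_gt0 Lw// mem_head.
have C1 : 0 < C + 1 by rewrite ltr_wpDl.
(* Within the second radius [L i] moves by less than [|L i w|]; the 1 avoids a zero denominator. *)
exists (Num.min e (`|L i w| / (C + 1))); first by rewrite lt_min e0 divr_gt0.
move=> w' [bw' w'w].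
have {}w'w : forall e', Num.min e (`|L i w| / (C + 1)) <= e' ->
    (C1_norm g (w' \- w)%R < e'%:E)%E.
  by move=> e' he; rewrite (lt_le_trans w'w)// lee_fin.
split => // j; rewrite inE => /orP[/eqP ->|jl]; last first.
  have [_] : nonzero_on l w'.
    by apply: eO; split => //; apply: w'w; rewrite ge_min lexx.
  exact.
have w'wi : (C1_norm g (w' \- w)%R < (`|L i w| / (C + 1))%:E)%E.
  by apply: w'w; rewrite ge_min lexx orbT.
have [s [t [s0 t0 st b]]] := C1_norm_lt (pt i) w'wi.
have := LC w w' s t bw bw' b.
apply: contraTneq => ->; rewrite sub0r normrN -ltNge.
move: st; rewrite ltr_pdivlMr// => /(le_lt_trans _); apply.
by rewrite mulrC ler_wpM2l ?addr_ge0// lerDl.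
Qed.

(** One condition at a time: approximate within e/2 by a [w1] satisfying the earlier ones, then push
    along [w0], by little enough to remain in their open set, if [L i w1] vanishes. *)
Lemma nonzero_on_dense l : C1_dense g (nonzero_on l).
Proof.
elim: l => [|i l IH] w e bw e0.
  exists w; split => //; split => //.
  have z : C1_bound g (w \- w) 0 0.
    have [w1 _ _] := bw; split => [m|m v _].
      by rewrite /= subrr normr0.
    by rewrite subf_lin tdiff_lin// mulN1r subrr normr0.
  by apply: le_lt_trans (C1_norm_le z) _; rewrite addr0 lte_fin.
have e20 : 0 < e / 2 by rewrite divr_gt0.
have [w1 [[bw1 w1w] Ow1]] := IH w (e / 2) bw e20.
have [_ /(_ _ Ow1)[e1 e10 e1O]] := nonzero_on_open l.
have [w0 [bw0 Lw0 Llin]] := L_nonzero i.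
have [s0 [t0 [s00 t00 b0]]] := bounded_C1P bw0.
have D0 : 0 < s0 + t0 + 1 by rewrite ltr_wpDl// addr_ge0.
(* [c * (s0 + t0)], the size of the perturbation, lies below both e/2 and the radius [e1] of the
   earlier conditions. *)
pose c := Num.min (e / 2) e1 / 2 / (s0 + t0 + 1).
have c0 : 0 < c by rewrite !divr_gt0// lt_min e20.
have [x [xc Lx]] : exists x : R, `|x| <= c /\ L i w1 + x * L i w0 != 0.
  have [L0|L0] := eqVneq (L i w1) 0.
    exists c; split; first by rewrite gtr0_norm.
    by rewrite L0 add0r mulf_neq0// gt_eqF.
  by exists 0; rewrite normr0 mul0r addr0 ltW.
pose w2 n := w1 n + x * w0 n.
have bw2 : bounded_C1 g w2 by exact: bounded_C1_lin.
have [w11 _ _] := bw1; have [w01 _ _] := bw0; have [w_1 _ _] := bw.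
have b21 : C1_bound g (w2 \- w1) (c * s0) (c * t0).
  have -> : w2 \- w1 = fun n => 0 + x * w0 n.
    by apply/funext => n; rewrite /w2/= addrAC subrr.
  have z1 : C1_fun (cst 0 : M -> R).
    rewrite (_ : cst 0 = w0 \- w0); first exact: C1_fun_sub.
    by apply/funext => n /=; rewrite subrr.
  split => [m|m v v1].
    by rewrite add0r normrM ler_pM//; case: b0.
  rewrite (@tdiff_lin _ _ _ (cst 0) w0 x m v z1 w01).
  have -> : tdiff (cst 0 : M -> R) m v = 0.
    exact: (congr1 (@^~ v) (diff_cst (0 : R) (base_coord m))).
  by rewrite add0r normrM ler_pM//; case: b0 => _; apply.
have cst : c * s0 + c * t0 < Num.min (e / 2) e1.
  rewrite -mulrDr; apply: (@lt_trans _ _ (c * (s0 + t0 + 1))).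
    by rewrite ltr_pM2l// ltrDl.
  rewrite /c divfK ?gt_eqF// ltr_pdivrMr// ltr_pMr ?ltr1n//.
  by rewrite lt_min e20.
exists w2; split; last first.
  split => // j; rewrite inE => /orP[/eqP ->|jl]; first by rewrite Llin.
  have [_] : nonzero_on l w2; last exact.
  apply: e1O; split => //; apply: le_lt_trans (C1_norm_le b21) _.
  by rewrite lte_fin (lt_le_trans cst)// ge_min lexx orbT.
split => //.
have [s [t [_ _ st b]]] := C1_norm_lt (pt i) w1w.
have b2 : C1_bound g (w2 \- w) (s + `|1| * (c * s0)) (t + `|1| * (c * t0)).
  have -> : w2 \- w = fun n => (w1 \- w) n + 1 * (w2 \- w1) n.
    by apply/funext => n /=; rewrite mul1r [RHS]addrC addrA subrK.
  have w21 : C1_fun w2 by case: bw2.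
  apply: (C1_bound_lin 1 _ _ b b21); exact: C1_fun_sub.
apply: le_lt_trans (C1_norm_le b2) _; rewrite lte_fin normr1 !mul1r addrACA.
rewrite (splitr e) ltrD// (lt_le_trans cst)// ge_min lexx//.
Qed.

End GenericNonzero.

(** * Test functions and test functionals *)

Section TestFunctions.
Variables (R : realType) (q : nat) (M : manifold R q) (g : riemannian M).

Lemma sqdist_gt0 (u : 'rV[R]_q) : u != 0 -> 0 < sqdist 0 u.
Proof.
move=> u0; have s0 : 0 <= sqdist 0 u by rewrite sumr_ge0// => i _; rewrite sqr_ge0.
rewrite lt_neqAle s0 andbT eq_sym; apply: contraNneq u0 => uE.
apply/eqP/rowP => i; rewrite mxE; apply/eqP; rewrite -sqrf_eq0.
have /eqP := uE; rewrite psumr_eq0 => [/allP/(_ i)|j _]; last exact: sqr_ge0.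
by rewrite mem_index_enum/= mxE subr0; exact.
Qed.

(* The bump is centred slightly off the base point, in the direction [- u]. *)
Lemma exists_tdiff_neq0 (m : M) (u : 'rV[R]_q) : u != 0 ->
  exists2 w, bounded_C1 g w & tdiff w m u != 0.
Proof.
move=> u0; have [r0 [r00 _ bb]] := bump_bounded g m.
set a := chart_at m in bb; set x0 := base_coord m in bb.
have S0 := sqdist_gt0 u0; set S := sqdist 0 u in S0.
have n0 : 0 < `|u| by rewrite normr_gt0.
pose r := r0 / 2; have rpos : 0 < r by rewrite divr_gt0.
(* [D] ensures [s * |u| < r], so that the bump fits in the ball of radius [r0], and
   [s ^+ 2 * S < r ^+ 2], so that the base point is interior to its support. *)
pose D := 1 + S + `|u|; have D0 : 0 < D by rewrite !addr_gt0.
pose s := r / D; have s0 : 0 < s by rewrite divr_gt0.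
have sD : s * D = r by rewrite /s divfK// gt_eqF.
have su : s * `|u| < r by rewrite -sD ltr_pM2l// /D; lra.
have sS : s ^+ 2 * S < r ^+ 2.
  have -> : r ^+ 2 = s ^+ 2 * D ^+ 2 by rewrite -exprMn sD.
  by rewrite ltr_pM2l ?exprn_gt0// /D; nra.
pose c := x0 - s *: u.
exists (bump_fun a c r).
  apply: bb => //; rewrite /c addrAC subrr add0r normrN normrZ gtr0_norm//.
  by rewrite /r in su *; lra.
rewrite (bump_tdiff c r (chart_at_atlas m) u (erefl a)).
have cu : x0 - c = s *: u by rewrite /c opprB addrC subrK.
have cS : sqdist c x0 = s ^+ 2 * S.
  rewrite /S /sqdist mulr_sumr; apply: eq_bigr => i _.
  have : (x0 - c) 0 i = (s *: u) 0 i by rewrite cu.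
  by rewrite !mxE subr0 => ->; rewrite exprMn.
rewrite /bell_slope cS cu max_r; last by rewrite subr_ge0 ltW.
have -> z : row_pairing (z *: (s *: u)^T) u = z * s * S.
  rewrite /row_pairing mxE /S mulr_sumr; apply: eq_bigr => i _.
  by rewrite !mxE subr0; ring.
rewrite mulNr !mulNr oppr_eq0 gt_eqF//.
by do 3 (apply: mulr_gt0 => //); rewrite subr_gt0.
Qed.

Lemma exists_separating (m m' : M) : m != m' ->
  exists2 w, bounded_C1 g w & w m != w m'.
Proof.
move=> mm'; have [r0 [r00 img bb]] := bump_bounded g m.
set a := chart_at m in img bb; set x0 := base_coord m in img bb.
have am : cdom a m := chart_at_dom m.
have wm r : 0 < r -> bump_fun a x0 r m != 0.
  move=> rpos; rewrite bump_in// /bell /sqdist big1 => [|i _].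
    by rewrite subr0 /possq max_r ?sqr_ge0// expf_neq0// expf_neq0// gt_eqF.
  by rewrite subrr expr0n.
have [am'|am'] := pselect (cdom a m').
  have d0 : 0 < `|cmap a m' - x0|.
    rewrite normr_gt0 subr_eq0; apply: contraNneq mm' => e.
    by apply/eqP; rewrite -(cmapK am) -[cmap a m]e cmapK.
  pose r := Num.min r0 `|cmap a m' - x0| / 2.
  have mn : 0 < Num.min r0 `|cmap a m' - x0| by rewrite lt_min r00.
  have rpos : 0 < r by rewrite divr_gt0.
  have rmn : r < Num.min r0 `|cmap a m' - x0| by rewrite /r; lra.
  exists (bump_fun a x0 r).
    by apply: bb => //; rewrite subrr normr0 add0r (lt_le_trans rmn)// ge_min lexx.
  rewrite (@bump_far _ _ _ a x0 r rpos m')//; first exact: wm.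
  by rewrite (lt_le_trans rmn)// ge_min lexx orbT.
have rpos : 0 < r0 / 2 by rewrite divr_gt0.
exists (bump_fun a x0 (r0 / 2)).
  by apply: bb => //; rewrite subrr normr0 add0r; lra.
have -> : bump_fun a x0 (r0 / 2) m' = 0.
  by rewrite /bump_fun; case: ifPn => // /set_mem.
exact: wm.
Qed.

(** Slope tests and separation tests share one index type, so that a single finite list carries all
    conditions. *)
Definition test_index : Type :=
  {p : M * 'rV[R]_q | p.2 != 0} + {p : M * M | p.1 != p.2}.

Definition test_point (i : test_index) : M :=
  match i with inl p => (val p).1 | inr p => (val p).1 end.

Definition test_value (i : test_index) (w : M -> R) : R :=
  match i with
  | inl p => tdiff w (val p).1 (val p).2
  | inr p => w (val p).1 - w (val p).2
  end.

Lemma test_value_lipschitz i : exists2 C : R, 0 <= C &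
  forall w w' (s t : R), bounded_C1 g w -> bounded_C1 g w' ->
    C1_bound g (w' \- w) s t -> `|test_value i w' - test_value i w| <= C * (s + t).
Proof.
case: i => [[[m u]/= u0]|[[m m']/= _]].
  have n0 := tangent_norm_gt0 g m u0; have n0' := ltW n0.
  exists (tangent_norm g m u) => // w w' s t [w1 _ _] [w'1 _ _] [ws wt].
  have s0 : 0 <= s by apply: le_trans (ws m).
  have := wt m ((tangent_norm g m u)^-1 *: u).
  rewrite tangent_normZ ger0_norm ?invr_ge0// mulVf ?gt_eqF// => /(_ (lexx _)).
  rewrite subf_lin tdiff_lin// mulN1r.
  have tZ v : tdiff v m ((tangent_norm g m u)^-1 *: u) =
      (tangent_norm g m u)^-1 * tdiff v m u.
    by rewrite /tdiff linearZ.
  rewrite !tZ -mulrBr normrM ger0_norm ?invr_ge0// ler_pdivrMl// => /le_trans; apply.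
  by rewrite ler_wpM2l// lerDr.
exists 2 => // w w' s t _ _ [ws wt].
have t0 : 0 <= t.
  apply: le_trans (wt m 0 _) => //.
  by rewrite /tangent_norm !mul0mx mxE sqrtr0.
have := ws m; have := ws m'; rewrite /= => h1 h2.
rewrite (_ : w' m - w' m' - _ = (w' m - w m) - (w' m' - w m')); last by ring.
by apply: le_trans (ler_normB _ _) _; lra.
Qed.

Lemma test_value_neq0 i : exists w0, [/\ bounded_C1 g w0, test_value i w0 != 0 &
  forall w (c : R), bounded_C1 g w -> test_value i (fun n => w n + c * w0 n) =
    test_value i w + c * test_value i w0].
Proof.
case: i => [[[m u]/= u0]|[[m m']/= mm']].
  have [w0 bw0 dw0] := exists_tdiff_neq0 m u0; exists w0; split => // w c [w1 _ _].
  by case: bw0 => w01 _ _; exact: tdiff_lin.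
have [w0 bw0 dw0] := exists_separating mm'; exists w0; split => //.
  by rewrite subr_eq0.
by move=> w c _; ring.
Qed.

Lemma generic_tests (l : seq test_index) :
  generic g (fun w => bounded_C1 g w /\ {in l, forall i, test_value i w != 0}).
Proof.
exists (nonzero_on g test_value l); split => //.
  exact: (nonzero_on_open test_point test_value_lipschitz).
exact: (nonzero_on_dense test_point test_value_lipschitz test_value_neq0).
Qed.

End TestFunctions.

(** * Immersion and separation at the fixed points *)

Lemma diff_sum_scale (R : realType) (E W : normedModType R) (I : Type) (r : seq I)
    (G : I -> E -> R) (v : I -> W) (x : E) :
  (forall i, differentiable (G i) x) ->
  differentiable (fun y => \sum_(i <- r) G i y *: v i) x /\
  forall h, 'd (fun y => \sum_(i <- r) G i y *: v i) x h =
    \sum_(i <- r) 'd (G i) x h *: v i.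
Proof.
move=> dG; elim: r => [|i r [dr drE]].
  have -> : (fun y => \sum_(i <- [::]) G i y *: v i) = cst (0 : W) :> (E -> W).
    by apply/funext => y; rewrite big_nil.
  split; first exact: differentiable_cst.
  by move=> h; rewrite big_nil; exact: (congr1 (@^~ h) (diff_cst _ _)).
have -> : (fun y => \sum_(i <- i :: r) G i y *: v i) =
    (fun y => G i y *: v i) + (fun y => \sum_(i <- r) G i y *: v i).
  by apply/funext => y; rewrite big_cons.
have di := differentiableZl (v i) (dG i).
split; first exact: differentiableD.
move=> h; rewrite big_cons; apply: (etrans (congr1 (@^~ h) (diffD di dr))).
congr (_ + _); last exact: drE.
exact: (congr1 (@^~ h) (diffZl (v i) (dG i))).
Qed.

(* At least one of the real and imaginary parts of an eigenvector is nonzero. *)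
Lemma exists_real_test_vector (R : realType) (q : nat) (J : 'M[R]_q)
    (lam : 'I_q -> R[i]) j : are_eigenvalues J lam ->
  exists (v : 'rV[R[i]]_q) (u : 'rV[R]_q),
    [/\ v *m map_mx (real_complex R) J = lam j *: v, u != 0 &
        forall p, row_pairing p u != 0 -> v *m map_mx (real_complex R) p != 0].
Proof.
move=> Jlam; have [v vJ v0] := eigenvector_of_spectrum j Jlam.
have parts (f : {additive R[i] -> R}) :
    (forall z (a : R), f (z * (real_complex R a)) = f z * a) ->
    forall p, row_pairing p (map_mx f v) != 0 ->
      v *m map_mx (real_complex R) p != 0.
  move=> fM p; apply: contraNneq => vp0.
  have /(congr1 f) : (v *m map_mx (real_complex R) p) 0 0 = 0 by rewrite vp0 mxE.
  rewrite raddf0 mxE raddf_sum => <-; rewrite /row_pairing mxE.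
  by apply/eqP/eq_bigr => i _; rewrite !mxE fM.
have [Re0|Re0] := eqVneq (map_mx (@complex.Re R) v) 0; last first.
  exists v, (map_mx (@complex.Re R) v); split => //.
  by apply: (parts (@complex.Re R : {additive _ -> _})) => -[a b] c /=;
      rewrite mulr0 subr0.
exists v, (map_mx (@complex.Im R) v); split => //; last first.
  by apply: (parts (@complex.Im R : {additive _ -> _})) => -[a b] c /=;
      rewrite mulr0 add0r.
apply: contraNneq v0 => Im0; apply/eqP/rowP => i; rewrite mxE.
have /rowP/(_ i) := Re0; have /rowP/(_ i) := Im0; rewrite !mxE.
by case: (v 0 i) => a b /= -> ->.
Qed.

Section FixedPoints.
Variables (R : realType) (q N : nat) (M : manifold R q) (g : riemannian M).
Variables (V : M -> 'rV[R]_q) (phi : R -> M -> M).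
Hypothesis V_smooth : smooth_vfield V.
Hypothesis phi_flow : is_flow V phi.
Hypothesis phi_C1 : forall t, C1_map (phi t).
Variables (b K : R).
Hypothesis K_ge0 : 0 <= K.
Hypothesis phi_bound : forall t : R, 0 <= t ->
  (ereal_sup [set tmap_norm g (phi (- t)%R) m | m in [set: M]]
      <= (K * expR (b * t))%:E)%E.
Variables (P : 'M[R]_N) (d : 'rV[R]_N) (C : 'cV[R]_N).
Hypothesis P_unit : P \in unitmx.
Hypothesis d_gt0 : forall i, 0 < d 0 i.
Hypothesis bd : forall i, b < d 0 i.
Let A := invmx P *m diag_mx d *m P.

Variable w : M -> R.
Hypothesis w_bounded : bounded_C1 g w.

Lemma gen_syncE n : gen_sync A C phi w n =
  invmx P *m \col_i ((P *m C) i 0 * flow_laplace phi w (d 0 i) n).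
Proof.
by apply: gen_sync_conj_diag => // i; exact: (integrable_orbit phi_flow w_bounded).
Qed.

Variable m : M.
Hypothesis m_fix : forall t, phi t m = m.

Lemma mul_gen_sync_fixed : A *m gen_sync A C phi w m = w m *: C.
Proof.
rewrite gen_syncE /A -!mulmxA mulKVmx// mul_diag_mx.
rewrite -[in RHS](mulKmx P_unit C) scalemxAr; congr (_ *m _).
apply/colP => i; rewrite mxE [in LHS]mxE [RHS]mxE mulrCA mulrC; congr (_ * _).
exact: flow_laplace_fixed.
Qed.

(** Up to the invertible [P], Df(m) is right multiplication by the matrix [L] of the scaled
    differentials of the scalar transforms, so injectivity is row-freeness of [L]. *)
Lemma immersion_fixed (lam : 'I_q -> R[i]) (v : 'I_q -> 'rV[R[i]]_q)
    (u : 'I_q -> 'rV[R]_q) :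
  (forall j, [/\ v j *m map_mx (real_complex R) (linearisation V m) = lam j *: v j,
     u j != 0 & forall p, row_pairing p (u j) != 0 ->
       v j *m map_mx (real_complex R) p != 0]) ->
  free [seq invmx (map_mx (real_complex R) A + (lam j)%:M)
                      *m map_mx (real_complex R) C | j : 'I_q] ->
  (forall j, tdiff w m (u j) != 0) -> immersion_at (gen_sync A C phi w) m.
Proof.
move=> vu fr wu; set a := chart_at m; set x0 := base_coord m.
pose p := \col_i tdiff w m (delta_mx 0 i).
have pE h : tdiff w m h = row_pairing p h.
  rewrite {1}[h]row_sum_delta /tdiff linear_sum /row_pairing mxE.
  by apply: eq_bigr => i _; rewrite linearZ mxE.
have /(@choice _ _ (fun i l => [/\ _, _ & _]))[l lP] i :=
  laplace_orbit_diff V_smooth phi_flow phi_C1 K_ge0 phi_bound w_bounded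
    (d_gt0 i) (bd i) m_fix.
have lp i : d 0 i *: l i + linearisation V m *m l i = p.
  have [_ _ H] := lP i; apply/colP => k.
  have := H (delta_mx 0 k); rewrite /row_pairing -!mulmxA -!rowE !mxE => ->.
  by [].
pose L := \matrix_(k < q, i < N) ((P *m C) i 0 * l i k 0).
have Lfree : row_free L.
  apply: (sylvester_row_free (J := linearisation V m) (v := v) (lam := lam)
    P_unit lp) => //.
    by move=> j; have [] := vu j.
  by move=> j; have [_ _] := vu j; apply; rewrite -pE.
pose G i := flow_laplace phi w (d 0 i) \o cinv a.
pose c i : 'cV[R]_N := (P *m C) i 0 *: col i (invmx P).
have fE : gen_sync A C phi w \o cinv a = fun y => \sum_i G i y *: c i.
  apply/funext => y; rewrite /= gen_syncE; apply/colP => k.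
  rewrite mxE summxE; apply: eq_bigr => i _.
  by rewrite !mxE /G/=; ring.
have dG i : differentiable (G i) x0 by have [] := lP i.
have [df dfE] := diff_sum_scale (index_enum 'I_N) c dG.
rewrite /immersion_at -/a -/x0 fE; split => //.
have tE h : tdiff (gen_sync A C phi w) m h = invmx P *m (h *m L)^T.
  rewrite /tdiff -/a -/x0 fE; apply: (etrans (dfE h)); apply/colP => k.
  rewrite summxE mxE; apply: eq_bigr => i _.
  have [_ H _] := lP i.
  have -> : (h *m L)^T i 0 = (P *m C) i 0 * row_pairing (l i) h.
    have -> : row_pairing (l i) h = \sum_k' h 0 k' * l i k' 0.
      by rewrite /row_pairing mxE.
    rewrite [LHS]mxE [LHS]mxE mulr_sumr.
    by apply: eq_bigr => k' _; rewrite [L _ _]mxE mulrCA.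
  rewrite (H h) [LHS]mxE [c i k 0]mxE [col _ _ _ _]mxE.
  by rewrite mulrC mulrAC [RHS]mulrC.
move=> h1 h2; rewrite !tE => /(can_inj (mulKVmx P_unit))/trmx_inj.
exact: (row_free_inj Lfree).
Qed.

End FixedPoints.

Theorem theorem4p8 (R : realType) (q N : nat) (q_ge1 : (1 <= q)%N)
  (N_geq : (q <= N)%N)
  (M : manifold R q) (g : riemannian M)
  (V : M -> 'rV[R]_q) (V_smooth : smooth_vfield V)
  (phi : R -> M -> M) (phi_flow : is_flow V phi)
  (phi_diff : forall t, Diff1 (phi t))
  (A : 'M[R]_N) (A_sym : A^T = A) (A_posdef : posdefmx A)
  (C : 'cV[R]_N)
  (sigma : R) (sigma_min : is_smallest_eigenvalue A sigma)
  (c K : R) (c_gt0 : 0 < c) (c_lt1 : c < 1) (K_gt0 : 0 < K)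
  (phi_bound : forall t : R, 0 <= t ->
    (ereal_sup [set tmap_norm g (phi (- t)%R) m | m in [set: M]]
      <= (K * expR (c * sigma * t))%:E)%E)
  (fixed_finite : finite_set (fixed_points phi))
  (fixed_spectrum : forall m, fixed_points phi m ->
    exists lam : 'I_q -> R[i],
      [/\ are_eigenvalues (linearisation V m) lam,
          injective lam &
          free [seq invmx (map_mx (real_complex R) A + (lam j)%:M)
                      *m map_mx (real_complex R) C | j : 'I_q]]) :
  generic g (fun w => embedding_on (gen_sync A C phi w) (fixed_points phi)).

Proof.
have phi_C1 t : C1_map (phi t) by case: (phi_diff t).
have K_ge0 := ltW K_gt0.
have [P [d [Pu AE]]] := symmetric_diagonalizable A_sym.
have d_eig i : eigenvalue A (d 0 i) by rewrite AE; exact: diag_eigenvalue.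
have d_gt0 i : 0 < d 0 i := posdef_eigenvalue_gt0 A_posdef (d_eig i).
have [sigma_eig sigma_le] := sigma_min.
have sigma_gt0 : 0 < sigma := posdef_eigenvalue_gt0 A_posdef sigma_eig.
have cd i : c * sigma < d 0 i.
  by apply: lt_le_trans (sigma_le _ (d_eig i)); rewrite gtr_pMl.
(* The test vectors depend on the linearisation only, so they are fixed before [w] and yield
   finitely many conditions. *)
have /choice[u uP] (m : M) : exists u : 'I_q -> 'rV[R]_q, fixed_points phi m ->
    (forall j, u j != 0) /\ forall w, bounded_C1 g w ->
      (forall j, tdiff w m (u j) != 0) -> immersion_at (gen_sync A C phi w) m.
  have [mfix|nfix] := pselect (fixed_points phi m); last by exists (fun=> 0).
  have [lam [lamE _ lam_free]] := fixed_spectrum _ mfix.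
  have /choice[v /choice[u uv]] j := exists_real_test_vector j lamE.
  exists u => _; split=> [j|w bw]; first by case: (uv j).
  move: lam_free; rewrite AE => lam_free.
  exact: (immersion_fixed V_smooth phi_flow phi_C1 K_ge0 phi_bound Pu d_gt0 cd
            bw mfix uv lam_free).
have [s sE] := (finite_seqP _).1 fixed_finite.
have fs m : fixed_points phi m = (m \in s) by rewrite sE.
(* [insub] retains exactly the nonzero vectors and the pairs of distinct fixed points. *)
pose l : seq (test_index M) :=
  map inl (pmap insub [seq (m, u m j) | m <- s, j <- enum 'I_q]) ++
  map inr (pmap insub [seq (m, m') | m <- s, m' <- s]).
have [U [Uopen Udense UP]] := generic_tests g l.
exists U; split => // w /UP[bw wl]; split.
- exact: finite_compact.
- move=> m mfix; have [u0 imm] := uP m mfix; apply: (imm _ bw) => j.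
  apply: (wl (inl (exist _ (m, u m j) (u0 j)))).
  rewrite mem_cat map_f// mem_pmap_sub; apply/allpairsP.
  by exists (m, j); split; rewrite //= ?mem_enum// -fs.
- move=> m m' /set_mem mfix /set_mem m'fix sync_eq; apply/eqP/negPn/negP => mm'.
  have : w m - w m' != 0.
    apply: (wl (inr (exist _ (m, m') mm'))).
    rewrite mem_cat orbC map_f// mem_pmap_sub; apply/allpairsP.
    by exists (m, m'); split; rewrite //= -fs.
  have wC n : fixed_points phi n -> A *m gen_sync A C phi w n = w n *: C.
    move=> nfix; rewrite AE.
    exact: (mul_gen_sync_fixed phi_flow C Pu d_gt0 bw nfix).
  have : (w m - w m') *: C = 0.
    by rewrite scalerBl -(wC _ mfix) -(wC _ m'fix) sync_eq subrr.
  (* Either [w] fails a separation test, or [C = 0]; the latter puts a zero vector in the free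
     family, which has a member because [1 <= q]. *)
  move=> /eqP; rewrite scaler_eq0 => /orP[/eqP -> /eqP//|/eqP C0 _].
  have [lam [_ _ /free_not0 lam_free]] := fixed_spectrum _ mfix.
  have /negP[] := lam_free _ (codom_f _ (Ordinal q_ge1)).
  by rewrite C0 map_mx0 mulmx0.
Qed.
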